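(* Let $q$ be a prime power, $n\geq 3$ and $U=U_n(q)$. Each irreducible character of $U$ of largest degree $q^{\mu(n)}$ factors uniquely into a tensor product of an almost faithful elementary character of $U$ with (the inflation to $U$ of) a largest degree irreducible character of $U_{\alpha_{2,n-2}}$. Therefore, \[N_{n,\mu(n)}(q)=(q-1)N_{n-2,\mu(n-2)}(q).\]
   Context: Let $q$ be a prime power and $U=U_n(q)$ the group of upper triangular $n\times n$ matrices over $\mathbb{F}_q$ with all diagonal entries $1$. All characters are complex. For $1\le i\le j\le n-1$, $\alpha_{i,j}=\alpha_i+\dots+\alpha_j$ denotes the positive roots of type $A_{n-1}$; $\Sigma^+$ is the set of all of them, and $X_{\alpha_{i,j}}=\{I_n+c\,e_{i,j+1}:c\in\mathbb{F}_q\}$ is the root subgroup, where $e_{i,j+1}$ is the matrix unit. For $\alpha=\alpha_{i,j}$: $arm(\alpha)=\{\alpha_{i,t}: i\le t<j\}$; $V_\alpha=\langle X_\beta:\beta\in\Sigma^+\setminus arm(\alpha)\rangle$. $\mathrm{Irr}(V_\alpha/[V_\alpha,V_\alpha])^*$ denotes the set of the $q-1$ linear characters $\lambda$ of $V_\alpha$ with $\lambda|_{X_\alpha}\ne 1_{X_\alpha}$ and $\lambda|_{X_\beta}=1_{X_\beta}$ for all $X_\beta\subset V_\alpha$, $\beta\neq\alpha$. For such $\lambda$, the induced character $\lambda^U$ is called an elementary character associated to $\alpha$. A character $\chi$ of a group $G$ is almost faithful if $\chi|_{Z(G)}\ne\chi(1)1_{Z(G)}$ (the almost faithful elementary characters of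 $U$ are those associated to $\alpha_{1,n-1}$). $U_{\alpha_{a,b}}=\langle X_{\alpha_{s,t}}: a\le s\le t\le b\rangle$ (interpreted as the trivial group when $b=a-1$), and $R_{\alpha_{a,b}}$ is the normal subgroup of $U$ generated by all $X_\beta$ not contained in $U_{\alpha_{a,b}}$. One has $U=R_{\alpha_{a,b}}\rtimes U_{\alpha_{a,b}}$, and characters of $U_{\alpha_{a,b}}$ are inflated to $U$ with $R_{\alpha_{a,b}}$ in the kernel. Note $U_{\alpha_{2,n-2}}\simeq U_{n-2}(q)$. $N_{n,e}(q)$ is the number of irreducible characters of $U_n(q)$ of degree $q^e$. $\mu(n)=m(m-1)$ if $n=2m$ and $\mu(n)=m^2$ if $n=2m+1$; the irreducible character degrees of $U_n(q)$ are precisely $q^e$, $0\le e\le\mu(n)$. *)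

(* Defs.v *)
From HB Require Import structures.
From mathcomp Require Import all_boot all_order all_algebra all_fingroup.
From mathcomp Require Import all_solvable all_field all_character.

Set Implicit Arguments.
Unset Strict Implicit.
Unset Printing Implicit Defensive.

Import GroupScope GRing.Theory.
Local Open Scope ring_scope.

(* The matrices of {'GL_n[F]} have size n.-1.+1, so everything below has its
   usual meaning for n > 0.  Matrix indices start at 0. *)

Section Unitriangular.

Variables (F : finFieldType) (n : nat).

Definition unitri : {set {'GL_n[F]}} :=
  [set g | [forall i : 'I_n.-1.+1, forall j : 'I_n.-1.+1,
     (j <= i)%N ==> (GLval g i j == (i == j)%:R)]].

Lemma unitriP (g : {'GL_n[F]}) :
  reflect (forall i j : 'I_n.-1.+1, (j <= i)%N -> GLval g i j = (i == j)%:R)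
          (g \in unitri).
Proof.
rewrite inE; apply: (iffP forallP) => [h i j le_ji | h i].
  by move/forallP: (h i) => /(_ j) /implyP/(_ le_ji)/eqP.
by apply/forallP => j; apply/implyP => /h ->.
Qed.

Lemma GL_eq1 (g : {'GL_n[F]}) :
  (forall i j, GLval g i j = (i == j)%:R) -> g = 1%g.
Proof. by move=> g1; apply/val_inj/matrixP => i j; rewrite [LHS]g1 [RHS]mxE. Qed.

Fact unitri_group_set : group_set unitri.
Proof.
apply/group_setP; split=> [|x y /unitriP Ux /unitriP Uy].
  by apply/unitriP => i j _; rewrite GL_1E mxE.
apply/unitriP => i j le_ji; rewrite GL_MxE mxE (bigD1 i) //= Ux // eqxx mul1r.
rewrite Uy // big1 ?addr0 // => k ne_ki.
have [le_ki | lt_ik] := leqP k i.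
  by rewrite Ux // eq_sym (negPf ne_ki) mul0r.
rewrite Uy ?(leq_trans le_ji (ltnW lt_ik)) //.
by rewrite -val_eqE /= gtn_eqF ?mulr0 // (leq_ltn_trans le_ji).
Qed.
Canonical unitri_group := Group unitri_group_set.

(* The pair (i, j) stands for the root alpha_i + ... + alpha_j. *)
Definition posroot (a : nat * nat) : bool := (0 < a.1 <= a.2)%N && (a.2 < n)%N.

(* The matrix unit e_{i,j+1} has 0-based indices i.-1 and j. *)
Definition root_subgroup (a : nat * nat) : {set {'GL_n[F]}} :=
  [set g | [exists c : F,
     GLval g == 1 + c *: delta_mx (inord a.1.-1) (inord a.2)]].

Definition root_union (P : pred (nat * nat)) : {set {'GL_n[F]}} :=
  \bigcup_(b : 'I_n * 'I_n | posroot (val b.1, val b.2)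
                             && P (val b.1, val b.2))
    root_subgroup (val b.1, val b.2).

Definition arm (a : nat * nat) : pred (nat * nat) :=
  [pred b | (b.1 == a.1) && (a.1 <= b.2 < a.2)%N].

Definition arm_compl_group (a : nat * nat) : {group {'GL_n[F]}} :=
  <<root_union [pred b | b \notin arm a]>>%G.

Definition interval_group (a b : nat) : {group {'GL_n[F]}} :=
  <<root_union [pred s | (a <= s.1)%N && (s.2 <= b)%N]>>%G.

(* The subgroup generated by all unitri-conjugates of a set is its normal
   closure. *)
Definition interval_radical (a b : nat) : {group {'GL_n[F]}} :=
  <<class_support
      (root_union [pred s | ~~ (root_subgroup s \subset interval_group a b)])
      unitri>>%G.

Lemma root_unionP (P : pred (nat * nat)) g :
  reflect (exists2 s, posroot s && P s & g \in root_subgroup s)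
          (g \in root_union P).
Proof.
apply: (iffP bigcupP) => [[s Ps Xg] | [[s t] /andP[pst Pst] Xg]].
  by exists (val s.1, val s.2).
have /andP[/andP[/= _ le_st] lt_tn] := pst.
by exists (Ordinal (leq_ltn_trans le_st lt_tn), Ordinal lt_tn); rewrite /= ?pst.
Qed.

Lemma root_subgroup_entry s (g : {'GL_n[F]}) (i j : 'I_n.-1.+1) :
    posroot s -> g \in root_subgroup s -> GLval g i j != (i == j)%:R ->
  s = (i.+1, nat_of_ord j).
Proof.
case: s => s t /andP[/andP[/= s_gt0 le_st] lt_tn].
rewrite inE => /existsP[c /eqP ->] /=; rewrite !mxE.
have n_gt0 : (0 < n)%N by apply: leq_ltn_trans lt_tn.
have lt_t : (t < n.-1.+1)%N by rewrite prednK.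
have lt_s : (s.-1 < n.-1.+1)%N.
  by rewrite (leq_ltn_trans (leq_pred s)) // (leq_ltn_trans le_st).
case: andP => [[/eqP-> /eqP->] _ | _]; last by rewrite mulr0 addr0 eqxx.
by rewrite !inordK // prednK.
Qed.

Lemma root_subgroup_sub_unitri s :
  posroot s -> root_subgroup s \subset unitri.
Proof.
move=> ps; apply/subsetP => g Xg; apply/unitriP => i j le_ji.
apply/eqP; apply: contraT => /(root_subgroup_entry ps Xg) s_ij.
by move: ps; rewrite s_ij /posroot /= ltnNge le_ji.
Qed.

Lemma root_union_sub_unitri P : root_union P \subset unitri.
Proof.
apply/subsetP => g /root_unionP[s /andP[ps _]].
exact: (subsetP (root_subgroup_sub_unitri ps)).
Qed.

Lemma gen_unitri : <<root_union predT>> = unitri.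
Proof.
apply/eqP; rewrite eqEsubset gen_subG root_union_sub_unitri /=.
pose N := n.-1.+1.
suffices elim_col m g : g \in unitri ->
    (forall i j : 'I_N, (i < j)%N -> GLval g i j != 0 -> (j * N + i < m)%N) ->
  g \in <<root_union predT>>.
  apply/subsetP => g Ug; apply: (elim_col (N * N)%N g Ug) => i j _ _.
  by apply: leq_trans (_ : (j.+1 * N)%N <= _)%N;
     rewrite ?leq_mul2r ?ltn_ord ?orbT // mulSnr ltn_add2l ltn_ord.
elim: m g => [|m IHm] g Ug small_g.
  suffices ->: g = 1%g by apply: group1.
  apply: GL_eq1 => i j.
  have [le_ji | lt_ij] := leqP j i; first by rewrite (unitriP _ Ug).
  rewrite -val_eqE /= ltn_eqF //.
  by apply/eqP; apply: contraT => /(small_g i j lt_ij).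
have code_inj (i j k l : 'I_N) :
  (j * N + i = l * N + k)%N -> i = k /\ j = l.
  move=> e; split; apply: val_inj => /=.
    by move/(congr1 (modn^~ N)): e; rewrite !modnMDl !modn_small.
  by move/(congr1 (divn^~ N)): e; rewrite !divnMDl // !divn_small // !addn0.
case: (pickP [pred x : 'I_N * 'I_N | (x.1 < x.2)%N && (x.2 * N + x.1 == m)%N])
    => [[i0 j0] /= /andP[lt0 /eqP code0] | no_code]; last first.
  apply: IHm => // i j lt_ij nz; have := small_g i j lt_ij nz.
  by rewrite ltnS leq_eqVlt; have /= := no_code (i, j); rewrite lt_ij => /= ->.
pose D : 'M[F]_N := delta_mx i0 j0; pose c := - GLval g i0 j0.
have DD : D *m D = 0.
  by rewrite mul_delta_mx_cond (negPf (_ : j0 != i0)) // -val_eqE /= gtn_eqF.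
have t_unit : 1 + c *: D \is a GRing.unit.
  have e : (1 + c *: D) * (1 - c *: D) = 1.
    rewrite mulrDl mul1r mulrBr mulr1 -[c *: D * _]/(c *: D *m (c *: D)).
    by rewrite -scalemxAl -scalemxAr DD !scaler0 subr0 subrK.
  by have [] := mulmx1_unit e.
pose t : {'GL_n[F]} := FinRing.unit (_ : finUnitRingType) t_unit.
have lt_j0 : (nat_of_ord j0 < n)%N.
  have := leq_trans lt0 (ltn_ord j0 : (j0 <= n.-1)%N); have := ltn_ord j0.
  move: (nat_of_ord j0) (nat_of_ord i0) => j i; rewrite /N.
  by case: (n) => [|k] /= lt_j lt_i.
have ps : posroot (i0.+1, nat_of_ord j0).
  by rewrite /posroot /= lt0.
have Xt : t \in root_subgroup (i0.+1, nat_of_ord j0).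
  by rewrite inE; apply/existsP; exists c; rewrite /= !inord_val.
have Gt : t \in <<root_union predT>>.
  by apply/mem_gen/root_unionP; exists (i0.+1, nat_of_ord j0); rewrite ?ps.
rewrite -(groupMr _ Gt).
have Ut := subsetP (root_subgroup_sub_unitri ps) t Xt.
have gtE k l : GLval (g * t) k l
    = GLval g k l + (if l == j0 then c * GLval g k i0 else 0).
  rewrite GL_MxE /= mulmxDr mulmx1 !mxE (bigD1 i0) //= !mxE eqxx /=.
  rewrite big1 ?addr0 => [|p ne_p]; last by rewrite !mxE (negPf ne_p) !mulr0.
  by case: eqP => _; rewrite ?mulr1 ?mulr0 // mulrC.
apply: IHm => [|k l lt_kl]; first by rewrite groupM.
rewrite gtE; case: (l =P j0) => [l_j0 | ne_l].
  rewrite l_j0 -code0 ltn_add2l; case: ltngtP => // [lt_i0k | /val_inj k_i0].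
    rewrite (unitriP _ Ug k i0 (ltnW lt_i0k)) -val_eqE /= gtn_eqF // mulr0 addr0.
    rewrite -l_j0 => nz; have := small_g k l lt_kl nz.
    by rewrite -code0 l_j0 ltnS leq_add2l leqNgt lt_i0k.
  by rewrite k_i0 (unitriP _ Ug i0 i0 (leqnn _)) eqxx mulr1 addrN eqxx.
rewrite addr0 => nz; have := small_g k l lt_kl nz.
rewrite ltnS leq_eqVlt; case: eqP => // code_kl.
by have [_ /ne_l] := code_inj k l i0 j0 (etrans code_kl (esym code0)).
Qed.

(* The radical lies in the group of matrices that are trivial inside the
   diagonal block of alpha_{a,b}, the complement in the group of those that are
   trivial outside of it. *)
Lemma interval_sdprod a b :
  interval_radical a b ><| interval_group a b = unitri.
Proof.
pose N := n.-1.+1; pose blk (i j : 'I_N) := (a <= i.+1)%N && (j <= b)%N.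
have blk_mid (i j k : 'I_N) : blk i j -> (i <= k)%N -> (k <= j)%N -> blk i k && blk k j.
  rewrite /blk => /andP[ai jb] ik kj.
  by rewrite ai jb (leq_trans kj) // (leq_trans ai).
pose H0 := [set g in unitri | [forall i : 'I_N, forall j : 'I_N,
  ~~ blk i j ==> (GLval g i j == (i == j)%:R)]].
have H0P g : reflect (g \in unitri /\
    forall i j, ~~ blk i j -> GLval g i j = (i == j)%:R) (g \in H0).
  rewrite [g \in H0]inE; apply: (iffP andP) => -[Ug h]; split=> //.
    by move=> i j bij; move/forallP/(_ i)/forallP/(_ j)/implyP/(_ bij)/eqP: h.
  by apply/forallP=> i; apply/forallP => j; apply/implyP => /h->.
pose K0 := [set g in unitri | [forall i : 'I_N, forall j : 'I_N,
  blk i j ==> (GLval g i j == (i == j)%:R)]].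
have K0P g : reflect (g \in unitri /\
    forall i j, blk i j -> GLval g i j = (i == j)%:R) (g \in K0).
  rewrite [g \in K0]inE; apply: (iffP andP) => -[Ug h]; split=> //.
    by move=> i j bij; move/forallP/(_ i)/forallP/(_ j)/implyP/(_ bij)/eqP: h.
  by apply/forallP=> i; apply/forallP => j; apply/implyP => /h->.
have blkM x x' y y' : x \in unitri -> x' \in unitri ->
    y \in unitri -> y' \in unitri ->
    (forall i j, blk i j -> GLval x i j = GLval x' i j) ->
    (forall i j, blk i j -> GLval y i j = GLval y' i j) ->
  forall i j, blk i j -> GLval (x * y) i j = GLval (x' * y') i j.
  move=> Ux Ux' Uy Uy' ex ey i j bij; rewrite !GL_MxE !mxE.
  apply: eq_bigr => k _; have [ik | ki] := leqP i k; last first.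
    rewrite (unitriP _ Ux) ?(unitriP _ Ux') 1?ltnW //.
    by rewrite -val_eqE /= gtn_eqF // !mul0r.
  have [kj | jk] := leqP k j; last first.
    rewrite (unitriP _ Uy) ?(unitriP _ Uy') 1?ltnW //.
    by rewrite -val_eqE /= gtn_eqF // !mulr0.
  by have /andP[/ex-> /ey->] := blk_mid i j k bij ik kj.
have gH0 : group_set H0.
  apply/group_setP; split=> [|x y /H0P[Ux hx] /H0P[Uy hy]].
    by apply/H0P; split=> [|i j _]; rewrite ?group1 // GL_1E mxE.
  apply/H0P; split=> [|i j nb]; first exact: groupM.
  have [le_ji | lt_ij] := leqP j i.
    by apply: (unitriP _ (groupM Ux Uy)).
  rewrite GL_MxE mxE; case: (leqP a i.+1) => ai.
    have bj : (b < j)%N by move: nb; rewrite /blk ai /= -ltnNge.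
    rewrite (bigD1 j) //= big1 ?addr0 => [|k ne_kj].
      by rewrite hx // hy ?eqxx ?mulr1 // /blk (leqNgt _ b) bj andbF.
    by rewrite hy ?(negPf ne_kj) ?mulr0 // /blk (leqNgt _ b) bj andbF.
  rewrite (bigD1 i) //= big1 ?addr0 => [|k ne_ki].
    by rewrite hx ?hy ?eqxx ?mul1r // /blk (leqNgt a) ai.
  by rewrite hx ?(eq_sym i) ?(negPf ne_ki) ?mul0r // /blk (leqNgt a) ai.
have gK0 : group_set K0.
  apply/group_setP; split=> [|x y /K0P[Ux hx] /K0P[Uy hy]].
    by apply/K0P; split=> [|i j _]; rewrite ?group1 // GL_1E mxE.
  apply/K0P; split=> [|i j bij]; first exact: groupM.
  rewrite (@blkM x 1%g y 1%g) ?mulg1 ?group1 ?GL_1E ?mxE // => k l bkl.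
    by rewrite hx // mxE.
  by rewrite hy // mxE.
have sHH0 : interval_group a b \subset Group gH0.
  rewrite gen_subG; apply/subsetP => g /root_unionP[s /andP[ps /= bs] Xg].
  apply/H0P; split=> [|i j nb].
    exact: (subsetP (root_subgroup_sub_unitri ps)).
  apply/eqP; apply: contraR nb => /(root_subgroup_entry ps Xg) s_ij.
  by move: bs; rewrite s_ij.
have nK0 : unitri \subset 'N(Group gK0).
  apply/subsetP => u Uu; rewrite inE; apply/subsetP => _ /imsetP[k K0k ->].
  have [Uk hk] := K0P _ K0k; apply/K0P; split=> [|i j bij]; first exact: groupJ.
  rewrite /conjg (@blkM u^-1%g u^-1%g (k * u)%g (1 * u)%g) ?groupM ?groupV ?group1 //.
    by rewrite mul1g mulVg GL_1E mxE.
  by apply: blkM; rewrite ?group1 // => p r bpr; rewrite hk // GL_1E mxE.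
have sRK0 : interval_radical a b \subset Group gK0.
  rewrite gen_subG class_supportEr; apply/bigcupsP => u Uu.
  rewrite -(normsP nK0 u Uu) conjSg.
  apply/subsetP => g /root_unionP[s /andP[ps /= nHs] Xg].
  apply/K0P; split=> [|i j bij].
    exact: (subsetP (root_subgroup_sub_unitri ps)).
  apply/eqP; apply: contraR nHs => /(root_subgroup_entry ps Xg) s_ij.
  apply/subsetP => x Xx; apply/mem_gen/root_unionP; exists s => //.
  by rewrite ps /= s_ij.
have sHU : interval_group a b \subset unitri.
  by rewrite gen_subG root_union_sub_unitri.
have nRU : unitri \subset 'N(interval_radical a b).
  by rewrite norms_gen // class_support_norm.
have sRU : interval_radical a b \subset unitri.
  by rewrite gen_subG class_support_subG // root_union_sub_unitri.
have nRH := subset_trans sHU nRU.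
rewrite sdprodE //; last first.
  apply/trivgP/subsetP => g /setIP[/(subsetP sRK0)/K0P[_ hK]].
  move=> /(subsetP sHH0)/H0P[_ hH]; rewrite inE; apply/eqP/GL_eq1.
  by move=> i j; case: (boolP (blk i j)) => [/hK | /hH].
rewrite -norm_joinEr //; apply/eqP; rewrite eqEsubset join_subG sRU sHU /=.
rewrite -gen_unitri gen_subG.
apply/subsetP => g /root_unionP[s /andP[ps _] Xg].
have [sH | nsH] := boolP (root_subgroup s \subset interval_group a b).
  by apply/(subsetP (joing_subr _ _))/(subsetP sH).
apply/(subsetP (joing_subl _ _))/mem_gen/(subsetP (sub_class_support _ _)).
by apply/root_unionP; exists s; rewrite ?ps.
Qed.

Definition almost_faithful (gT : finGroupType) (G : {group gT})
    (chi : 'CF(G)) : Prop :=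
  'Res['Z(G)] chi <> chi 1%g *: 1.

Definition elementary_linear (a : nat * nat) (lam : 'CF(arm_compl_group a)) :
    Prop :=
  [/\ lam \is a linear_char,
      exists2 x, x \in root_subgroup a & lam x != 1
    & forall b, posroot b -> root_subgroup b \subset arm_compl_group a ->
        b != a -> {in root_subgroup b, forall x, lam x = 1}].

Definition elementary (chi : 'CF(unitri)) : Prop :=
  exists a, posroot a /\ exists2 lam : 'CF(arm_compl_group a),
    elementary_linear lam & chi = 'Ind[unitri] lam.

Definition inflate (a b : nat) (theta : 'CF(interval_group a b)) :
    'CF(unitri) :=
  cfSdprod (interval_sdprod a b) theta.

Definition num_irr_deg (e : nat) : nat :=
  #|[set i : Iirr unitri | 'chi_i 1%g == (#|F| ^ e)%N%:R]|.

End Unitriangular.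

Definition largest_degree_irr (gT : finGroupType) (G : {group gT})
    (chi : 'CF(G)) : Prop :=
  chi \in irr G /\ forall i : Iirr G, ('chi_i 1%g <= chi 1%g)%R.

(* m(m - 1) for n = 2m, m^2 for n = 2m + 1. *)
Definition mu (n : nat) : nat :=
  if odd n then (n./2 * n./2)%N else (n./2 * n./2.-1)%N.

(* Main.v *)
Require Import Defs.
From mathcomp Require Import all_boot all_order all_algebra all_fingroup.
From mathcomp Require Import all_solvable all_field all_character.
From mathcomp Require Import zify.

Set Implicit Arguments.
Unset Strict Implicit.
Unset Printing Implicit Defensive.

Import GroupScope GRing.Theory Order.TTheory Num.Theory.
Local Open Scope ring_scope.

(** Write q for the order of F, U for U_n(q), and number the rows and columns
    from 0.  Let V be the group of matrices of U that differ from 1 only in the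
    first row, X the group of those that differ from 1 only in the corner
    (0, n-1), R the group of those that differ from 1 only in the first row and
    the last column, and H the group of those that agree with 1 there.  Then X is the
    center of U, U = R ><| H and H is a copy of U_{n-2}.

    An irreducible character chi of U is a multiple of a linear character
    lambda on X, and the two cases for lambda are settled by the same remark.
    Suppose that chi is trivial on the entries of the first row to the right of
    column j, but not on the entry j.  If x in V has a nonzero entry (0, i)
    with 0 < i < j, then conjugation by 1 + c e_{ij} changes x only in the entry
    (0, j), by a prescribed amount, so that chi x = 0.  Averaging chi over the
    subgroup K of V of matrices with entry (0, j) equal to zero then gives a
    positive number: chi has vectors fixed by K (row_fixed).  If K contains the
    derived group of a group M, it follows that chi is a constituent of a
    character induced from a linear character of M that is trivial on K
    (lin_constt_fixed).

    If lambda is nontrivial, this applies to the constituents theta of chi on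
    R, with j = n-1 and M = V.  The fixed vectors of K force theta(1) to be a
    multiple of q^(n-2), which is the index of V in R; hence theta is induced
    from V and is determined by lambda (hook_irr).  The elementary character
    attached to lambda has degree q^(n-2), so it restricts to the same theta,
    and Gallagher's theorem yields chi as its product with the inflation of a
    unique irreducible character of H (elem_factor).

    If lambda is trivial, then chi(1) <= q^(mu(n) - 1) (degenerate_irr1_le).
    Here j < n-1, and M is spanned by V, by the entries (a, b) with
    1 <= a <= h < b and b <> j, where h is the integral part of (n-2)/2, and
    by the entry (j, n-1).  Apart from the first row this is at least one
    dimension more than the largest abelian block of U_{n-2}, which is what
    pushes |U : M| strictly below q^mu(n).

    As mu(n) = mu(n-2) + (n-2), induction on n shows that q^mu(n) is the
    largest degree.  The characters of this degree are therefore over a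
    nontrivial lambda, and they correspond to the pairs formed by one of the
    q-1 nontrivial characters of X and a character of H of degree
    q^mu(n-2). *)

(** * Characters and fixed vectors of subgroups *)

Section Characters.

Variable gT : finGroupType.
Implicit Types G H K M X : {group gT}.

Lemma cfdot_Res_vanish G H K (chi : 'CF(G)) : K \subset G -> H \subset K ->
    H \subset cfker chi -> {in K, forall x, x \notin H -> chi x = 0} ->
  '['Res[K] chi, 1] = #|H|%:R / #|K|%:R * chi 1%g.
Proof.
move=> sKG sHK kerH chi0; rewrite cfdotE [_ / _]mulrC -mulrA; congr (_ * _).
rewrite (big_setID H) /= (setIidPr sHK) [X in _ + X]big1 ?addr0.
  rewrite (eq_bigr (fun=> chi 1%g)) ?sumr_const ?mulr_natl // => x Hx.
  have Kx := subsetP sHK x Hx; rewrite cfResE // cfun1E Kx conjC1 mulr1.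
  exact: cfker1 (subsetP kerH x Hx).
by move=> x /setDP[Kx /(chi0 _ Kx)]; rewrite cfResE // => ->; rewrite mul0r.
Qed.

(** Some constituent of chi on M has vectors fixed by K.  These form a submodule,
    because K is normal in M, so that K, and with it the derived group of M,
    acts trivially on this constituent. *)
Lemma lin_constt_fixed G M K i : K \subset M -> M \subset G ->
    [~: M, M] \subset K -> '['Res[K] 'chi[G]_i, 1] != 0 ->
  exists j : Iirr M, [/\ 'chi_j \is a linear_char, K \subset cfker 'chi_j
                       & i \in irr_constt ('Ind[G] 'chi_j)].
Proof.
move=> sKM sMG sM'K; have nsKM : K <| M by apply: sub_der1_normal.
rewrite -(cfResRes _ sKM sMG) [X in 'Res[K] X]cfun_sum_constt.
rewrite linear_sum /= cfdot_suml => nz.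
have [j chi_j nz_j] : exists2 j, j \in irr_constt ('Res[M] 'chi_i)
    & '['Res[K] 'chi_j, 1] != 0.
  apply/exists_inP; apply: contraR nz => /exists_inPn no_j.
  rewrite big1 // => j /no_j/negPn/eqP e.
  by rewrite linearZ /= cfdotZl e mulr0.
have kerK : K \subset cfker 'chi_j.
  by rewrite constt0_Res_cfker // irr_consttE irr0.
exists j; split=> //; last by rewrite constt_Ind_Res.
by rewrite lin_irr_der1 (subset_trans sM'K).
Qed.

(** The image of z is central in the quotient of G by the kernel of the
    character, where Schur's lemma applies. *)
Lemma mem_cfcenter G i z : z \in G ->
  {in G, forall y, [~ z, y] \in cfker 'chi[G]_i} -> z \in 'Z('chi_i)%CF.
Proof.
move=> Gz comm_z; have [sKG nKG] := andP (cfker_normal 'chi_i).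
have nKz := subsetP nKG z Gz.
have : coset (cfker 'chi_i) z \in 'Z(G / cfker 'chi_i)%g.
  rewrite inE mem_quotient //=; apply/centP=> _ /morphimP[y nKy Gy ->].
  by apply/commgP; rewrite -morphR //= coset_id ?comm_z.
rewrite -cfcenter_eq_center => /morphimP[w nKw Zw zw].
have : z \in cfker 'chi_i :* w.
  by rewrite -[_ :* w]val_coset // -zw val_coset // rcoset_refl.
case/rcosetP=> k Kk ->; rewrite groupM //.
exact: subsetP (normal_sub (cfker_center_normal _)) k Kk.
Qed.

(** As z acts as a scalar a, chi x = chi (x z) = a chi x, with a <> 1. *)
Lemma cfcenter_vanish G i x y z : z \in 'Z('chi[G]_i)%CF ->
    x \in G -> y \in G -> (x ^ y)%g = (x * z)%g -> 'chi_i z != 'chi_i 1%g ->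
  'chi_i x = 0.
Proof.
move=> Zz Gx Gy xyE; have Gz := subsetP (cfcenter_sub _) z Zz.
have : 'chi_i (x * z)%g = 'chi_i x by rewrite -xyE cfunJ.
move: Zz; rewrite -irrRepr cfcenter_repr => /setIdP[_ /is_scalar_mxP[a rz]].
rewrite !cfunE Gx Gz groupM // group1 !mulr1n repr_mxM // rz repr_mx1.
rewrite mul_mx_scalar !linearZ /= => e ne.
apply: contraNeq ne => nz; have -> : a = 1.
  by apply: (mulIf nz); rewrite mul1r.
by rewrite eqxx.
Qed.

(** All constituents on X of a constituent of psi are constituents of psi on X,
    and 'chi_k is the only one of these. *)
Lemma isotypic_constt G X (psi : 'CF(G)) t k : X \subset G ->
    psi \is a character -> 'chi[X]_k \is a linear_char ->
    'Res[X] psi = psi 1%g *: 'chi_k -> t \in irr_constt psi ->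
  'Res[X] 'chi_t = 'chi_t 1%g *: 'chi_k.
Proof.
move=> sXG Npsi lin_k psiX psi_t.
have sub_k : {subset irr_constt ('Res[X] 'chi_t) <= pred1 k}.
  move=> j /(constt_Res_trans Npsi psi_t).
  rewrite psiX irr_consttE cfdotZl cfdot_irr inE (eq_sym k).
  by case: (j == k); rewrite // mulr0 eqxx.
have e : 'Res[X] 'chi_t = '['Res[X] 'chi_t, 'chi_k] *: 'chi_k.
  rewrite {1}['Res _]cfun_sum_cfdot (bigD1 k) //= big1 ?addr0 // => j ne_jk.
  apply/eqP; rewrite scaler_eq0; apply/orP; left.
  by apply: contraNT ne_jk => /sub_k.
have := congr1 (fun f : 'CF(X) => f 1%g) e.
by rewrite /= cfRes1 cfunE (lin_char1 lin_k) mulr1 => ->.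
Qed.

Lemma isotypic_center G X i : X \subset 'Z(G) ->
  exists k, 'Res[X] 'chi[G]_i = 'chi_i 1%g *: 'chi_k.
Proof.
move=> sXZ; have sZc : X \subset 'Z('chi_i)%CF.
  by apply: subset_trans sXZ _; rewrite -cap_cfcenter_irr (bigcap_inf i).
have [xi lin_xi chiZ] := cfcenter_Res 'chi_i.
have /irrP[k xiX] := lin_char_irr (cfRes_lin_char X lin_xi).
exists k; rewrite -(cfResRes _ sZc (cfcenter_sub _)) chiZ -xiX.
by rewrite linearZ.
Qed.

Lemma cfInd_center G H (phi : 'CF(H)) z : H \subset G -> z \in 'Z(G) ->
  'Ind[G] phi z = #|G : H|%:R * phi z.
Proof.
move=> sHG /centerP[Gz cGz]; rewrite cfIndE // (eq_bigr (fun=> phi z)).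
  rewrite sumr_const -[phi z *+ _]mulr_natl mulrA -(Lagrange sHG) natrM mulrA.
  by rewrite mulVf ?mul1r // neq0CG.
by move=> y Gy; rewrite conjgE cGz // mulKg.
Qed.

Lemma constt_eq_deg G (psi : 'CF(G)) t : psi \is a character ->
  t \in irr_constt psi -> psi 1%g <= 'chi_t 1%g -> psi = 'chi_t.
Proof.
move=> Npsi /(constt_charP _ Npsi)[phi Nphi ->]; rewrite cfunE => le_deg.
suffices -> : phi = 0 by rewrite addr0.
apply/eqP; rewrite -char1_eq0 // eq_le char1_ge0 // andbT.
by rewrite -(lerD2l ('chi_t 1%g)) addr0.
Qed.

(** Gallagher's theorem, for a normal subgroup K that has a complement H: the
    characters of G / K are the inflations of those of H. *)
Lemma gallagher_sdprod G K H (defG : K ><| H = G) (chi : 'CF(G)) :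
    chi \in irr G -> 'Res[K] chi \in irr K ->
  [/\ forall j : Iirr H, chi * cfSdprod defG 'chi_j \in irr G,
      {in irr H &, injective (fun theta => chi * cfSdprod defG theta)}
    & forall c, '['Res[K] 'chi_c, 'Res[K] chi] != 0 ->
        exists j, 'chi_c = chi * cfSdprod defG 'chi_j].
Proof.
case/irrP=> e -> /irrP[t eN]; have [nsKG sHG _ _ _] := sdprod_context defG.
have [irrM injM codomM _] := constt_Ind_ext nsKG eN.
have mulE (b : Iirr (G / K)) : 'chi_(mul_mod_Iirr e b) = 'chi_e * 'chi_(mod_Iirr b).
  by rewrite [RHS]mulrC; apply: cfIirrE (irrM b).
have infl j : {b : Iirr (G / K) | 'chi_(mod_Iirr b) = cfSdprod defG 'chi_j}.
  exists (quo_Iirr K (sdprod_Iirr defG j)).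
  by rewrite quo_IirrK // sdprod_IirrE ?cfker_sdprod.
split=> [j | _ _ /irrP[j1 ->] /irrP[j2 ->] | c nz].
- by have [b <-] := infl j; rewrite mulrC.
- have [[b1 e1] [b2 e2]] := (infl j1, infl j2); rewrite /= -e1 -e2 => e12.
  have /injM eb : mul_mod_Iirr e b1 = mul_mod_Iirr e b2.
    by apply: irr_inj; rewrite !mulE.
  by apply: (cfSdprod_inj (defG := defG)); rewrite -e1 -e2 eb.
have /codomP[b ->] : c \in codom (@mul_mod_Iirr _ G K e).
  by rewrite -codomM constt_Ind_Res irr_consttE -eN.
have kerb : K \subset cfker 'chi_(mod_Iirr b) by rewrite mod_IirrE ?cfker_mod.
have /irrP[j Dj] := Res_sdprod_irr defG kerb (mem_irr _).
by exists j; rewrite mulE -Dj cfRes_sdprodK.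
Qed.

End Characters.

(** * Counting matrix positions *)
Section Combinatorics.

Lemma card_ord_interval n a b :
  (b <= n)%N -> #|[set i : 'I_n | (a <= i < b)%N]| = (b - a)%N.
Proof.
move=> le_bn; rewrite -sum1dep_card -(big_mkord (fun i => a <= i < b)%N (fun=> 1%N)).
rewrite -[RHS]muln1 -sum_nat_const_nat (big_nat_widenl a 0) //.
by rewrite (big_nat_widen 0 b n).
Qed.

Lemma card_ord_pairs n :
  #|[set p : 'I_n * 'I_n | (p.1 < p.2)%N]| = 'C(n, 2).
Proof.
rewrite -sum1dep_card -(pair_big_dep xpredT (fun i j : 'I_n => i < j)%N (fun _ _ => 1%N)).
rewrite -bin2_sum big_mkord [RHS](reindex_inj rev_ord_inj) /=.
apply: eq_bigr => i _; rewrite sum1dep_card -(card_ord_interval i.+1 (leqnn n)).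
by apply: eq_card => j; rewrite !inE ltn_ord andbT.
Qed.

Lemma mu_double m : mu m.*2 = (m * m.-1)%N.
Proof. by rewrite /mu odd_double doubleK. Qed.

Lemma mu_doubleS m : mu m.*2.+1 = (m * m)%N.
Proof. by rewrite /mu /= odd_double /= uphalf_double. Qed.

(** The exponent grows by n - 2, the exponent of the degree of an almost
    faithful elementary character. *)
Lemma mu_rec n : (1 < n)%N -> mu n = (mu (n - 2) + (n - 2))%N.
Proof.
case: n => // -[] // n _; rewrite subn2 /=.
rewrite -(odd_double_half n); move: n./2 (odd n) => m [].
  by rewrite add1n -doubleS !mu_doubleS; lia.
by rewrite add0n -doubleS !mu_double; case: m => [|m] //=; lia.
Qed.

(** Above the diagonal there are n - 1 positions in the first row, h (n - 2 - h)
    in a largest abelian rectangle for U_{n-2}, and mu n is what remains. *)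
Lemma bin2_mu n (h := (n - 2)./2) : (1 < n)%N ->
  ('C(n, 2) = mu n + (n.-1 + h * (n - 2 - h)))%N.
Proof.
rewrite /h => {h}; case: n => // -[] // n _; rewrite subn2 /=.
have : ('C(n.+2, 2).*2 = n.+2 * n.+1)%N by rewrite -mul2n mul_bin_left bin1 mulnC subn1.
move: 'C(n.+2, 2) => c.
rewrite -(odd_double_half n); move: n./2 (odd n) => m []; rewrite ?add1n ?add0n.
  by rewrite -doubleS mu_doubleS /= uphalf_double; lia.
by rewrite -doubleS mu_double doubleK; lia.
Qed.

End Combinatorics.

(** * Pattern groups *)
Section Patterns.

Variables (F : finFieldType) (n : nat).

Local Notation N := n.-1.+1.
Implicit Types (g x y : {'GL_n[F]}) (A B : 'M[F]_N) (i j k : 'I_N).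

(** A relation is regarded as the set of positions (i, j) with i < j that satisfy
    it.  This is the containment that governs products of matrix units:
    e_{ij} e_{jk} = e_{ik}. *)
Definition comp_sub (P Q K : rel 'I_N) :=
  forall i j k, (i < j)%N -> (j < k)%N -> P i j -> Q j k -> K i k.

Record pattern := Pattern {
  pat_rel :> rel 'I_N;
  pat_closed : comp_sub pat_rel pat_rel pat_rel }.

Implicit Types P Q K : pattern.

(** Restricting to positions above the diagonal lets a pattern be given by a
    condition on rows and columns alone. *)
Definition supported (P : rel 'I_N) A :=
  forall i j, ~~ ((i < j)%N && P i j) -> A i j = 0.

Definition pat P : {set {'GL_n[F]}} :=
  [set g | [forall i : 'I_N, forall j : 'I_N,
     ~~ ((i < j)%N && P i j) ==> (GLval g i j == (i == j)%:R)]].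

Lemma patP P g : reflect (supported P (GLval g - 1)) (g \in pat P).
Proof.
rewrite inE; apply: (iffP forallP) => [h i j nP | h i].
  move/forallP: (h i) => /(_ j)/implyP/(_ nP)/eqP e.
  by rewrite !mxE e subrr.
apply/forallP=> j; apply/implyP => /h/eqP.
by rewrite !mxE subr_eq0.
Qed.

Lemma pat_entry P g i j :
  g \in pat P -> ~~ ((i < j)%N && P i j) -> GLval g i j = (i == j)%:R.
Proof. by move/patP => h /h/eqP; rewrite !mxE subr_eq0 => /eqP. Qed.

Lemma supported_add (P : rel 'I_N) A B :
  supported P A -> supported P B -> supported P (A + B).
Proof. by move=> hA hB i j nP; rewrite mxE hA ?hB ?addr0. Qed.

Lemma supported_opp (P : rel 'I_N) A : supported P A -> supported P (- A).
Proof. by move=> hA i j nP; rewrite mxE hA ?oppr0. Qed.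

Lemma supported_mul (P Q K : rel 'I_N) A B : comp_sub P Q K ->
  supported P A -> supported Q B -> supported K (A *m B).
Proof.
move=> PQK hA hB i k nK; rewrite mxE big1 // => j _.
case: (boolP ((i < j)%N && P i j)) => [/andP[ij Pij] | /hA->]; last first.
  by rewrite mul0r.
case: (boolP ((j < k)%N && Q j k)) => [/andP[jk Qjk] | /hB->]; last first.
  by rewrite mulr0.
by move: nK; rewrite (ltn_trans ij jk) (PQK _ _ _ ij jk).
Qed.

Lemma pat_mulmx P (K : rel 'I_N) x A : comp_sub P K K ->
  x \in pat P -> supported K A -> supported K (GLval x *m A).
Proof.
move=> PK /patP Px KA; rewrite -[GLval x](subrK 1) mulmxDl mul1mx.
by apply: supported_add => //; apply: supported_mul Px KA.
Qed.

Lemma mulmx_pat P (K : rel 'I_N) x A : comp_sub K P K ->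
  x \in pat P -> supported K A -> supported K (A *m GLval x).
Proof.
move=> PK /patP Px KA; rewrite -[GLval x](subrK 1) mulmxDr mulmx1.
by apply: supported_add => //; apply: supported_mul KA Px.
Qed.

Fact pat_group_set P : group_set (pat P).
Proof.
apply/group_setP; split=> [|x y Px Py].
  by apply/patP=> i j _; rewrite GL_1E !mxE subrr.
apply/patP; rewrite GL_MxE -[GLval x](subrK 1) [_ *m _]mulmxDl mul1mx -addrA.
apply: supported_add; last exact/patP.
by apply: mulmx_pat Py _; [apply: pat_closed | apply/patP].
Qed.
Canonical pat_group P := Group (pat_group_set P).

Lemma pat_sub P Q : (forall i j, (i < j)%N -> P i j -> Q i j) ->
  pat P \subset pat Q.
Proof.
move=> sPQ; apply/subsetP=> g /patP Pg; apply/patP => i j nQ; apply: Pg.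
by apply: contra nQ => /andP[lt_ij /sPQ->]; rewrite ?lt_ij.
Qed.

Definition full := @Pattern (fun _ _ => true) (fun _ _ _ _ _ _ _ => isT).

Lemma pat_full : pat full = unitri F n.
Proof.
apply/setP=> g; apply/idP/unitriP => [Pg i j le_ji | h].
  by rewrite (pat_entry Pg) // ltnNge le_ji.
apply/patP => i j; rewrite andbT -leqNgt => /h e.
by rewrite !mxE e subrr.
Qed.

Lemma pat_sub_unitri P : pat P \subset unitri F n.
Proof. by rewrite -pat_full pat_sub. Qed.

Lemma pat_norm P Q : comp_sub P Q Q -> comp_sub Q P Q ->
  pat P \subset 'N(pat Q).
Proof.
move=> PQ QP; apply/subsetP=> y Py; rewrite inE.
apply/subsetP=> _ /imsetP[x /patP Qx ->]; apply/patP.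
have yK : GLval y^-1%g *m GLval y = 1 by rewrite -GL_MxE mulVg GL_1E.
have -> : GLval (x ^ y)%g - 1 = GLval y^-1%g *m ((GLval x - 1) *m GLval y).
  by rewrite mulmxBl mul1mx mulmxBr yK -!GL_MxE.
apply: (pat_mulmx (P := P)) => //; first exact: groupVr.
by apply: mulmx_pat Py _.
Qed.

(** With x = 1 + a and y = 1 + b, the commutator of x and y is
    1 + x^-1 y^-1 (ab - ba). *)
Lemma pat_commg P Q K : comp_sub P Q K -> comp_sub Q P K ->
  comp_sub P K K -> comp_sub Q K K -> [~: pat P, pat Q] \subset pat K.
Proof.
move=> PQ QP PK QK; rewrite gen_subG; apply/subsetP=> _ /imset2P[x y Px Qy ->].
apply/patP.
have -> : GLval [~ x, y]%g - 1 = GLval x^-1%g *m (GLval y^-1%g *m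
    ((GLval x - 1) *m (GLval y - 1) - (GLval y - 1) *m (GLval x - 1))).
  have -> : (GLval x - 1) *m (GLval y - 1) - (GLval y - 1) *m (GLval x - 1)
      = GLval (x * y)%g - GLval (y * x)%g.
    have cancel (u v w : 'M[F]_N) : (u - w) - (v - w) = u - v.
      by rewrite opprB addrA subrK.
    rewrite (mulmxBl _ _ (GLval y - 1)) (mulmxBr (GLval y - 1)) mul1mx mulmx1.
    by rewrite cancel mulmxBl mulmxBr mul1mx mulmx1 cancel !GL_MxE.
  rewrite !mulmxBr -!GL_MxE; congr (_ - _).
  by rewrite mulKg mulVg GL_1E.
apply: (pat_mulmx PK) => //; first exact: groupVr.
apply: (pat_mulmx QK); first exact: groupVr.
apply: supported_add; first by apply: supported_mul PQ _ _; apply/patP.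
by apply/supported_opp; apply: supported_mul QP _ _; apply/patP.
Qed.

(** A total function, so that group elements can be given by their entries and
    no proof of invertibility has to be carried along. *)
Definition gl A : {'GL_n[F]} := insubd (1%g : {'GL_n[F]}) A.

Lemma glK A : supported full (A - 1) -> GLval (gl A) = A.
Proof.
move=> sA; apply: insubdK; rewrite -[_ \in _]/(A \in unitmx) unitmxE.
have Aij i j : (j <= i)%N -> A i j = (i == j)%:R.
  rewrite leqNgt => /negbTE lt_ij.
  by move: (sA i j); rewrite lt_ij !mxE => /(_ isT)/eqP; rewrite subr_eq0 => /eqP.
rewrite -det_tr det_trig; last first.
  apply/is_trig_mxP => i j lt_ij; rewrite mxE Aij ?(ltnW lt_ij) //.
  by rewrite -val_eqE /= gtn_eqF.
by rewrite big1 ?unitr1 // => i _; rewrite mxE Aij ?eqxx.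
Qed.

Lemma supported_full (P : rel 'I_N) A : supported P A -> supported full A.
Proof. by move=> sA i j; rewrite andbT => h; apply: sA; rewrite (negPf h). Qed.

Lemma gl_pat P A : supported P (A - 1) -> gl A \in pat P.
Proof. by move=> sA; apply/patP; rewrite glK //; apply: supported_full sA. Qed.

(** The entries in the positions of P can be chosen independently. *)
Lemma card_pat P :
  #|pat P| = (#|F| ^ #|[set p : 'I_N * 'I_N | (p.1 < p.2)%N && P p.1 p.2]|)%N.
Proof.
set D := [set p | _]; have <- := card_pffun_on (0 : F) D predT.
pose h (f : {ffun 'I_N * 'I_N -> F}) : 'M[F]_N := \matrix_(i, j) f (i, j).
have sh f : f \in pffun_on 0 D predT -> supported P (h f).
  case/pffun_onP => sf _ i j nP; rewrite mxE; apply/eqP; apply: contraR nP => nz.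
  by have /(subsetP sf) : (i, j) \in support f by []; rewrite inE.
have hE f i j : h f i j = f (i, j) by rewrite mxE.
have glh f : f \in pffun_on 0 D predT -> GLval (gl (1 + h f)) = 1 + h f.
  by move/sh => sf; rewrite glK // addrAC subrr add0r; apply: supported_full sf.
rewrite -(card_in_imset (f := fun f => gl (1 + h f))); last first.
  move=> f1 f2 /glh e1 /glh e2 e; apply/ffunP=> [[i j]].
  by rewrite -!hE; congr (fun_of_matrix _ i j); apply: (addrI 1); rewrite -e1 -e2 e.
apply: eq_card => g; apply/idP/imsetP => [Pg | [f Df ->]]; last first.
  by apply: gl_pat; rewrite addrAC subrr add0r; apply: sh.
exists [ffun p => (GLval g - 1) p.1 p.2].
  apply/pffun_onP; split=> //; apply/subsetP=> [[i j]]; rewrite !inE ffunE /=.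
  by apply: contraR => nP; rewrite (patP _ _ Pg).
apply/val_inj/esym; rewrite [LHS]glK; last first.
  apply: supported_full (_ : supported P _) => i j nP.
  by rewrite addrAC subrr add0r mxE ffunE (patP _ _ Pg).
by apply/matrixP => i j; rewrite !mxE ffunE !mxE addrC subrK.
Qed.

Lemma indexg_pat P Q : (forall i j, (i < j)%N -> Q i j -> P i j) ->
  #|pat P : pat Q|
    = (#|F| ^ #|[set p : 'I_N * 'I_N | [&& p.1 < p.2, P p.1 p.2 & ~~ Q p.1 p.2]%N]|)%N.
Proof.
move=> sQP; apply/eqP; rewrite -(eqn_pmul2l (cardG_gt0 (pat_group Q))) /=.
rewrite Lagrange ?pat_sub // !card_pat -expnD; apply/eqP; congr (_ ^ _)%N.
rewrite addnC -(cardsID [set p | Q p.1 p.2] [set p : 'I_N * 'I_N | _ && P _ _]) addnC.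
congr (_ + _)%N; apply: eq_card => [[i j]]; rewrite !inE /= -?andbA.
  by rewrite andbCA; case: (boolP (i < j)%N) => //= _; rewrite andbC.
by case: (boolP (i < j)%N) => //= lt_ij; case Qij: (Q i j); rewrite ?andbF // sQP.
Qed.

(** The two factors meet trivially because their supports are disjoint; they
    span the whole group by cardinality. *)
Lemma pat_sdprod P1 P2 P :
    (forall i j, (i < j)%N -> P i j = P1 i j (+) P2 i j) ->
    (forall i j, (i < j)%N -> P1 i j -> P i j) ->
    comp_sub P2 P1 P1 -> comp_sub P1 P2 P1 ->
  pat P1 ><| pat P2 = pat P.
Proof.
move=> defP sP1 P21 P12.
have sP2 i j : (i < j)%N -> P2 i j -> P i j.
  move=> lt_ij P2ij; move: (sP1 i j lt_ij); rewrite defP // P2ij addbT.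
  by case: (P1 i j) => // /(_ isT).
have dP i j : (i < j)%N -> P1 i j -> ~~ P2 i j.
  by move=> lt_ij P1ij; move: (sP1 i j lt_ij P1ij); rewrite defP // P1ij.
have TI : pat P1 :&: pat P2 = 1%g.
  apply/trivgP/subsetP=> g /setIP[P1g P2g]; rewrite inE; apply/eqP/GL_eq1 => i j.
  case: (boolP ((i < j)%N && P1 i j)) => [/andP[lt_ij /dP]|nP].
    by move=> nP2; rewrite (pat_entry P2g) // negb_and nP2 ?orbT.
  exact: pat_entry P1g nP.
rewrite sdprodE ?pat_norm //; apply/eqP; rewrite eqEcard mul_subG ?pat_sub //=.
rewrite (TI_cardMg (G := pat_group P1) (H := pat_group P2)) // !card_pat -expnD.
rewrite leq_eqVlt; apply/orP; left; apply/eqP; congr (_ ^ _)%N.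
rewrite -cardsUI [X in (_ + X)%N](_ : _ = 0%N) ?addn0; last first.
  apply/eqP; rewrite cards_eq0 -subset0; apply/subsetP=> [[i j]].
  by rewrite !inE /= => /andP[/andP[lt_ij /(dP _ _ lt_ij)/negPf->]]; rewrite andbF.
apply: eq_card => [[i j]]; rewrite !inE /=; case: (boolP (i < j)%N) => //= lt_ij.
by rewrite defP //; case P1ij: (P1 i j); rewrite ?(negPf (dP _ _ _ P1ij)).
Qed.

End Patterns.

(** * Transvections and generation by root subgroups *)
Section RootSubgroups.

Variables (F : finFieldType) (n : nat).

Local Notation N := n.-1.+1.
Implicit Types (g x y : {'GL_n[F]}) (i j k : 'I_N) (P Q : pattern n).

Definition transv i j (c : F) : {'GL_n[F]} := gl (1 + c *: delta_mx i j).

Lemma transv_supported (P : rel 'I_N) i j c : (i < j)%N -> P i j ->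
  supported P (1 + c *: delta_mx i j - 1 : 'M[F]_N).
Proof.
move=> lt_ij Pij k l nP; rewrite addrAC subrr add0r !mxE.
by case: eqP nP => [->|_]; case: eqP => [->|_]; rewrite ?mulr0 // lt_ij Pij.
Qed.

Lemma transvE i j c : (i < j)%N -> GLval (transv i j c) = 1 + c *: delta_mx i j.
Proof. by move=> lt_ij; apply/glK/transv_supported. Qed.

Lemma mem_transv P i j c : (i < j)%N -> P i j -> transv i j c \in pat F P.
Proof. by move=> lt_ij Pij; apply/gl_pat/transv_supported. Qed.

Lemma mulmx_transv (A : 'M[F]_N) i j c k l : (i < j)%N ->
  (A *m GLval (transv i j c)) k l = A k l + (c * A k i) *+ (l == j).
Proof.
move=> lt_ij; rewrite transvE // mulmxDr mulmx1 mxE; congr (_ + _).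
rewrite -scalemxAr mxE mxE (bigD1 i) //= big1 => [|m ne_mi].
  by rewrite mxE eqxx addr0 /=; case: eqP; rewrite ?mulr1 // !mulr0.
by rewrite mxE (negPf ne_mi) mulr0.
Qed.

Lemma transv_mulmx (A : 'M[F]_N) i j c k l : (i < j)%N ->
  (GLval (transv i j c) *m A) k l = A k l + (c * A j l) *+ (k == i).
Proof.
move=> lt_ij; rewrite transvE // mulmxDl mul1mx mxE; congr (_ + _).
rewrite -scalemxAl mxE mxE (bigD1 j) //= big1 => [|m ne_mj].
  by rewrite mxE eqxx addr0 andbT /=; case: eqP; rewrite ?mul1r // mul0r mulr0.
by rewrite mxE (negPf ne_mj) andbF mul0r.
Qed.

Lemma posroot_of_ord i j : (i < j)%N -> posroot n (i.+1, nat_of_ord j).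
Proof.
rewrite /posroot /= => lt_ij; rewrite lt_ij /=.
move: (nat_of_ord i) (nat_of_ord j) (ltn_ord j) lt_ij => a b.
by case: n => [|m] //=; rewrite ltnS leqn0 => /eqP->.
Qed.

Lemma transv_root i j c :
  (i < j)%N -> transv i j c \in root_subgroup F n (i.+1, nat_of_ord j).
Proof.
by move=> lt_ij; rewrite inE; apply/existsP; exists c; rewrite transvE //= !inord_val.
Qed.

Lemma root_subgroup_transv i j g : (i < j)%N ->
  g \in root_subgroup F n (i.+1, nat_of_ord j) -> exists c, g = transv i j c.
Proof.
move=> lt_ij; rewrite inE => /existsP[c /eqP gE]; exists c; apply: val_inj.
by rewrite /= gE -[RHS]/(GLval _) transvE //= !inord_val.
Qed.

Lemma root_union_sub P (Q : pred (nat * nat)) :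
  (forall i j, (i < j)%N -> Q (i.+1, nat_of_ord j) -> P i j) ->
  <<root_union F n Q>> \subset pat F P.
Proof.
move=> sQP; rewrite gen_subG; apply/subsetP => g /root_unionP[s /andP[ps Qs] Xg].
apply/patP => i j nP; apply/eqP; rewrite !mxE subr_eq0.
apply: contraR nP => /(root_subgroup_entry ps Xg) s_ij.
have lt_ij : (i < j)%N by move: ps; rewrite s_ij => /andP[].
by rewrite lt_ij sQP // -s_ij.
Qed.

(** If j is the first column in which g differs from the identity, then right
    multiplication by a transvection in column j adds a multiple of a column of
    the identity matrix.  It can thus clear any chosen entry of column j and
    leave all the others unchanged. *)
Lemma sub_gen_root_union P (Q : pred (nat * nat)) :
  (forall i j, (i < j)%N -> P i j -> Q (i.+1, nat_of_ord j)) ->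
  pat F P \subset <<root_union F n Q>>.
Proof.
move=> sPQ; apply/subsetP => g.
pose S g := [set p : 'I_N * 'I_N | (p.1 < p.2)%N && (GLval g p.1 p.2 != 0)].
have [m le_Sm] := ubnP #|S g|; elim: m g le_Sm => // m IHm g le_Sm Pg.
have [S0 | [p0 Sp0]] := set_0Vmem (S g).
  suffices ->: g = 1%g by apply: group1.
  apply: GL_eq1 => i j; have [le_ji | lt_ij] := leqP j i.
    by rewrite (pat_entry Pg) // ltnNge le_ji.
  have := in_set0 (i, j); rewrite -S0 inE /= lt_ij /= => /negbFE/eqP->.
  by rewrite -val_eqE /= ltn_eqF.
have [[i j]] := @arg_minnP _ p0 [in S g] (fun p => nat_of_ord p.2) Sp0.
rewrite inE => /andP[lt_ij nz_ij] min_j.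
have Pij : P i j.
  apply: contraR nz_ij => nP; rewrite (pat_entry Pg) ?(negPf nP) ?andbF //.
  by rewrite -val_eqE /= ltn_eqF.
pose t := transv i j (- GLval g i j).
have Gt : t \in <<root_union F n Q>>.
  apply/mem_gen/root_unionP; exists (i.+1, nat_of_ord j); last exact: transv_root.
  by rewrite posroot_of_ord ?sPQ.
have gtE k l : GLval (g * t)%g k l = GLval g k l *+ ((k, l) != (i, j)).
  rewrite GL_MxE mulmx_transv // xpair_eqE andbC.
  case: eqP => [-> | _]; last by rewrite addr0.
  have -> : GLval g k i = (k == i)%:R.
    have [le_ik | lt_ki] := leqP i k; first by rewrite (pat_entry Pg) // ltnNge le_ik.
    rewrite -val_eqE /= ltn_eqF //; apply/eqP; apply: contraLR lt_ij => nz.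
    by rewrite -leqNgt; apply: (min_j (k, i)); rewrite inE /= lt_ki.
  by case: eqP => [->|_]; rewrite /= ?mulr1 ?subrr // mulr0 addr0.
rewrite -(groupMr _ Gt); apply: IHm; last by rewrite groupM // mem_transv.
rewrite -ltnS; apply: leq_trans le_Sm; rewrite ltnS; apply: proper_card.
apply/properP; split.
  apply/subsetP=> [[k l]]; rewrite !inE /= gtE => /andP[->].
  by apply: contraNneq => ->; rewrite mul0rn.
by exists (i, j); rewrite inE /= ?lt_ij // gtE eqxx mulr0n eqxx andbF.
Qed.

Lemma gen_root_union P (Q : pred (nat * nat)) :
  (forall i j, (i < j)%N -> P i j = Q (i.+1, nat_of_ord j)) ->
  <<root_union F n Q>> = pat F P.
Proof.
move=> PQ; apply/eqP; rewrite eqEsubset root_union_sub ?sub_gen_root_union //.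
  by move=> i j /PQ->.
by move=> i j /PQ->.
Qed.

Lemma pat_subP P (H : {group {'GL_n[F]}}) :
    (forall i j c, (i < j)%N -> P i j -> transv i j c \in H) ->
  pat F P \subset H.
Proof.
move=> PH; pose R (s : nat * nat) :=
  [exists p : 'I_N * 'I_N, [&& p.1 < p.2, P p.1 p.2 & s == (p.1.+1, nat_of_ord p.2)]%N].
apply: (@subset_trans _ _ <<root_union F n R>>).
  apply: sub_gen_root_union => i j lt_ij Pij.
  by apply/existsP; exists (i, j); rewrite lt_ij Pij /=.
rewrite gen_subG; apply/subsetP=> g /root_unionP[s /andP[_ /existsP[[i j]]]].
case/and3P=> /= lt_ij Pij /eqP-> /(root_subgroup_transv lt_ij)[c ->].
exact: PH.
Qed.

Lemma mem_transv_pat P i j c : (i < j)%N ->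
  transv i j c \in pat F P = (c == 0) || P i j.
Proof.
move=> lt_ij; case Pij: (P i j); first by rewrite orbT mem_transv.
rewrite orbF; apply/idP/eqP => [Pt | ->].
  have := pat_entry Pt (i := i) (j := j); rewrite Pij andbF => /(_ isT).
  rewrite transvE // !mxE !eqxx mulr1 -val_eqE /= ltn_eqF //.
  by rewrite add0r.
apply/patP => k l _; rewrite transvE // scale0r addr0 subrr mxE //.
Qed.

End RootSubgroups.

(** * The patterns of the proof *)
Section SpecialPatterns.

Variable n : nat.
Local Notation N := n.-1.+1.
Implicit Types (i j k : 'I_N).

Lemma ord0_lt i j : (i < j)%N -> j != ord0.
Proof. by rewrite -val_eqE -lt0n; apply: leq_trans. Qed.

Lemma ord_max_lt i j : (i < j)%N -> i != ord_max.
Proof. by move=> lt_ij; rewrite -val_eqE neq_ltn (leq_trans lt_ij (leq_ord j)). Qed.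

Fact row_closed (S : pred 'I_N) (P := fun i j => (i == ord0) && S j) : comp_sub P P P.
Proof. by move=> i j k /ord0_lt/negPf-j0 _ _; rewrite /P j0. Qed.
Definition row_pattern S := Pattern (@row_closed S).

Definition corner := row_pattern (pred1 ord_max).

Fact below_closed (P := fun i j : 'I_N => i != ord0) : comp_sub P P P.
Proof. by []. Qed.
Definition below := Pattern below_closed.

Fact hook_closed (P := fun i j : 'I_N => (i == ord0) || (j == ord_max)) :
  comp_sub P P P.
Proof.
by move=> i j k _ /ord_max_lt/negPf-j_max /orP[i0 _ | ]; rewrite /P ?i0 ?j_max.
Qed.
Definition hook := Pattern hook_closed.

Fact middle_closed (P := fun i j : 'I_N => (i != ord0) && (j != ord_max)) :
  comp_sub P P P.
Proof. by rewrite /P => i j k _ _ /andP[-> _] /andP[_ ->]. Qed.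
Definition middle := Pattern middle_closed.

Fact arm_compl_closed (P := fun i j : 'I_N => (i != ord0) || (j == ord_max)) :
  comp_sub P P P.
Proof.
by move=> i j k _ /ord_max_lt/negPf-j_max /orP[i0 _ | ]; rewrite /P ?i0 ?j_max.
Qed.
Definition arm_compl_pattern := Pattern arm_compl_closed.

(** The first row, where the commutators will end up, and a set of positions in
    the other rows that is abelian and avoids column j0.  The extra position
    (j0, n-1) can be added since j0 is not a column of the set. *)
Definition block_rel (j0 : 'I_N) (h : nat) : rel 'I_N := fun i j =>
  [|| i == ord0, [&& 0 < i, i <= h, h < j & j != j0]%N
    | (i == j0) && (j == ord_max)].

(** Composing two positions always lands in the first row, and never in column
    j0, which contains no position below the first row. *)
Lemma block_comp (j0 : 'I_N) h : (0 < j0)%N -> (j0 < n.-1)%N ->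
  comp_sub (block_rel j0 h) (block_rel j0 h) (row_pattern [pred j | j != j0]).
Proof.
move=> j0_gt0 j0_lt i j k lt_ij lt_jk; rewrite /block_rel /=.
rewrite (negPf (ord0_lt lt_ij)) (negPf (ord_max_lt lt_jk)) andbF orbF.
case/orP=> [i0 | /and4P[i_gt0 i_h h_j j_j0]].
  rewrite i0 /= => /orP[/and4P[] // | /andP[_ /eqP->]].
  by rewrite -val_eqE gtn_eqF.
by rewrite (negPf j_j0) orbF (leqNgt j) h_j !andbF.
Qed.

Fact block_closed (j0 : 'I_N) h (j0_gt0 : (0 < j0)%N) (j0_lt : (j0 < n.-1)%N) :
  comp_sub (block_rel j0 h) (block_rel j0 h) (block_rel j0 h).
Proof.
move=> i j k lt_ij lt_jk Pij Pjk.
have /andP[i0 _] := block_comp j0_gt0 j0_lt lt_ij lt_jk Pij Pjk.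
by rewrite /block_rel i0.
Qed.
Definition block j0 h j0_gt0 j0_lt := Pattern (@block_closed j0 h j0_gt0 j0_lt).

End SpecialPatterns.

(** * Cardinals and indices *)

Section UnitriangularGroups.

Variables (F : finFieldType) (n : nat).
Local Notation N := n.-1.+1.
Local Notation U := (unitri_group F n).
Local Notation pat := (pat F).
Implicit Types (i j k : 'I_N) (P Q : pattern n).

Lemma card_row (S : pred 'I_N) :
  #|pat (row_pattern S)| = (#|F| ^ #|[set j : 'I_N | (0 < j)%N && S j]|)%N.
Proof.
rewrite card_pat; congr (_ ^ _)%N.
rewrite -[RHS]mul1n -[X in (X * _)%N](cards1 (@ord0 n.-1)) -cardsX.
apply: eq_card => [[i j]]; rewrite !inE /=.
by case: (i =P ord0) => [-> | _]; rewrite ?andbF.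
Qed.

Lemma card_inner : #|[set j : 'I_N | 0 < j < n.-1]%N| = (n - 2)%N.
Proof. by rewrite card_ord_interval // -subn1 -subnDA. Qed.

Lemma indexg_arm_compl :
  #|U : pat (arm_compl_pattern n)| = (#|F| ^ (n - 2))%N.
Proof.
rewrite /= -pat_full indexg_pat // -card_inner; congr (_ ^ _)%N.
rewrite -[RHS]mul1n -[X in (X * _)%N](cards1 (@ord0 n.-1)) -cardsX.
apply: eq_card => [[i j]].
rewrite !inE /= negb_or negbK; case: (i =P ord0) => [-> | _]; rewrite ?andbF //=.
by rewrite -val_eqE /= (ltn_neqAle j) leq_ord andbT.
Qed.

Lemma indexg_hook_row :
  #|pat (hook n) : pat (@row_pattern n predT)| = (#|F| ^ (n - 2))%N.
Proof.
rewrite indexg_pat => [|i j _ /andP[/= -> _] //].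
rewrite -card_inner; congr (_ ^ _)%N.
rewrite -[RHS]muln1 -[X in (_ * X)%N](cards1 (@ord_max n.-1)) -cardsX.
apply: eq_card => [[i j]].
rewrite !inE /= !andbT -(inj_eq val_inj i) /=; case: (posnP i) => [-> | _] /=.
  by rewrite !andbF.
by case: (j =P ord_max) => [-> | _]; rewrite ?andbT ?andbF.
Qed.

End UnitriangularGroups.

Section Bound.
Variables (F : finFieldType) (n : nat).
Local Notation N := n.-1.+1.
Local Notation U := (unitri_group F n).
Local Notation pat := (pat F).
Implicit Types (i j k : 'I_N) (P Q : pattern n).

(** The rows 1, ..., h and the columns h+1, ..., n-1 without j0 form a rectangle.
    If j0 > h it has h (n - 2 - h) positions, and (j0, n-1) lies outside of it.
    If j0 <= h no column is lost, which makes up for (j0, n-1). *)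
Lemma card_block_ge (j0 : 'I_N) h : (0 < j0)%N -> (j0 < n.-1)%N -> (h <= n - 2)%N ->
  (n.-1 + (h * (n - 2 - h)).+1
     <= #|[set p : 'I_N * 'I_N | (p.1 < p.2)%N && block_rel j0 h p.1 p.2]|)%N.
Proof.
move=> j0_gt0 j0_lt le_h; set S := [set p | _].
pose T := setX [set @ord0 n.-1] [set j : 'I_N | 0 < j < N]%N.
pose R := [set i : 'I_N | 0 < i < h.+1]%N.
pose C := [set j : 'I_N | h < j < N]%N :\ j0.
pose D := setX R C :|: [set (j0, ord_max)].
have dTD : [disjoint T & D].
  apply/pred0P => [[i j]] /=; rewrite !inE /= xpair_eqE.
  case: (i =P ord0) => //= ->.
  by rewrite (eq_sym ord0) (negPf (ord0_lt (i := ord0) j0_gt0)) andbF.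
have sTD : T :|: D \subset S.
  apply/subsetP=> [[i j]]; rewrite !inE /= => /orP[/andP[/eqP-> /andP[lt_j _]] | ].
    by rewrite /block_rel eqxx lt_j.
  case/orP=> [/andP[/andP[i_gt0 i_h] /and3P[ne_j h_j _]] | /eqP[-> ->]].
    rewrite (leq_trans i_h h_j) /block_rel i_gt0 h_j ne_j -ltnS i_h.
    by rewrite /= orbT.
  by rewrite /block_rel !eqxx /= j0_lt !orbT.
apply: leq_trans (subset_leq_card sTD).
rewrite cardsU (disjoint_setI0 dTD) cards0 subn0 cardsX cards1 mul1n.
rewrite card_ord_interval ?leqnn // subn1 /= leq_add2l.
have cR : #|R| = h by rewrite card_ord_interval ?subn1 //; lia.
have cC : (#|[set j : 'I_N | h < j < N]%N| = n.-1 - h)%N.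
  by rewrite card_ord_interval // subSS.
have [le_j0 | lt_j0] := leqP j0 h.
  apply: leq_trans (subset_leq_card (subsetUl _ _)).
  rewrite cardsX cR (_ : #|C| = n.-1 - h)%N; first nia.
  by rewrite -cC; apply/esym; rewrite (cardsD1 j0) inE ltnNge le_j0.
rewrite cardsU (_ : _ :&: _ = set0); last first.
  apply/setP=> [[i j]]; rewrite !inE /=.
  case: (_ =P (j0, _)) => [[-> _]|]; rewrite ?andbF //.
  by rewrite (ltnS j0) (leqNgt j0) lt_j0 !andbF.
rewrite cards0 subn0 cards1 cardsX cR addn1 ltnS leq_mul2l; apply/orP; right.
by move: cC; rewrite (cardsD1 j0) -/C inE lt_j0 ltn_ord; lia.
Qed.

(** This is where h = (n - 2)./2 matters: it maximizes h (n - 2 - h). *)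
Lemma indexg_block_le (j0 : 'I_N) (j0_gt0 : (0 < j0)%N) (j0_lt : (j0 < n.-1)%N) :
  (#|U : pat (block (n - 2)./2 j0_gt0 j0_lt)| * #|F| <= #|F| ^ mu n)%N.
Proof.
have F_gt0 : (0 < #|F|)%N by apply/card_gt0P; exists 0.
set M := block _ _ _; have sMU : pat M \subset U := pat_sub_unitri F M.
rewrite -(leq_pmul2l (cardG_gt0 (pat_group F M))) mulnA Lagrange //=.
rewrite -pat_full !card_pat -expnSr -expnD leq_pexp2l //.
have -> : [set p : 'I_N * 'I_N | (p.1 < p.2)%N && full n p.1 p.2]
        = [set p : 'I_N * 'I_N | (p.1 < p.2)%N].
  by apply/setP=> p; rewrite !inE andbT.
have n_gt1 : (1 < n)%N by lia.
rewrite card_ord_pairs.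
have -> : 'C(N, 2) = 'C(n, 2) by rewrite prednK // ltnW.
rewrite bin2_mu // -addnS [leqRHS]addnC leq_add2l -addnS.
by apply: card_block_ge; lia.
Qed.

(** * The center and the first row *)

(** On the first row, right multiplication by 1 + c e_{ij} adds c times the entry
    i to the entry j. *)
Lemma row_conj_transv (x : {'GL_n[F]}) i j c :
    x \in pat (row_pattern predT) -> (0 < i)%N -> (i < j)%N ->
  (x ^ transv i j c = x * transv ord0 j (c * GLval x ord0 i)%R)%g.
Proof.
move=> Vx i_gt0 lt_ij; have j_gt0 : (0 < j)%N := ltn_trans i_gt0 lt_ij.
have xE k l : k != ord0 -> GLval x k l = (k == l)%:R.
  by move=> k0; rewrite (pat_entry Vx) //= (negPf k0) andbF.
have x0 k : GLval x k ord0 = (k == ord0)%:R by rewrite (pat_entry Vx).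
apply: (mulgI (transv i j c)); rewrite -conjgC; set d := c * _.
suffices: GLval (x * transv i j c)%g = GLval (transv i j c * (x * transv ord0 j d))%g.
  exact: val_inj.
apply/matrixP => k l; rewrite !GL_MxE mulmx_transv // transv_mulmx // !mulmx_transv //.
rewrite !x0 (negPf (ord0_lt lt_ij)) mulr0 mul0rn addr0.
have [-> | k0] := eqVneq k ord0.
  by rewrite mulr1 [_ == i]eq_sym -(inj_eq val_inj i) /= gtn_eqF // mulr0n addr0.
rewrite mulr0 mul0rn addr0 xE // (xE k i) // (xE j l) ?(ord0_lt lt_ij) //.
by congr (_ + _); rewrite (eq_sym l); case: (j == l); case: (k == i);
   rewrite ?mulr1 ?mulr0.
Qed.

Lemma pat_pred0 : pat (@row_pattern n pred0) = 1%g.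
Proof.
apply/eqP; rewrite eqEsubset sub1G andbT.
by apply: (pat_subP (H := [1 _])) => i j c _ /andP[].
Qed.

Lemma corner_sub_center : pat (corner n) \subset 'Z(U).
Proof.
rewrite subsetI pat_sub_unitri /= -pat_full; apply/commG1P/trivgP.
rewrite -pat_pred0; apply: pat_commg => i j k lt_ij lt_jk //=.
- by rewrite (negPf (ord_max_lt lt_jk)) andbF.
- by rewrite (negPf (ord0_lt lt_ij)).
- by rewrite !andbF.
by rewrite andbF.
Qed.

(** Commutation with 1 + e_{0i} kills the entries of row i for i > 0, and
    commutation with 1 + e_{j,n-1} kills the entry (0, j) for j < n-1. *)
Lemma center_unitri : 'Z(U) = pat (corner n).
Proof.
apply/eqP; rewrite eqEsubset corner_sub_center andbT; apply/subsetP=> g.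
case/centerP=> Ug cUg; rewrite /= -pat_full in Ug.
have gE (k l : 'I_N) : (l <= k)%N -> GLval g k l = (k == l)%:R.
  by move=> le_lk; rewrite (pat_entry Ug) // ltnNge le_lk.
have cg (i j : 'I_N) (lt_ij : (i < j)%N) k l :
    (GLval g k l + GLval g k i *+ (l == j) = GLval g k l + GLval g j l *+ (k == i)).
  rewrite -[GLval g k i]mul1r -[GLval g j l]mul1r.
  rewrite -(mulmx_transv _ 1 _ _ lt_ij) -(transv_mulmx _ 1 _ _ lt_ij) -!GL_MxE.
  by rewrite (cUg (transv i j 1)) //= -pat_full mem_transv.
apply/patP => i j nP; apply/eqP; rewrite !mxE subr_eq0; apply/eqP.
have [le_ji | lt_ij] := leqP j i; first exact: gE.
rewrite -val_eqE /= (ltn_eqF lt_ij); apply/eqP.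
have [i0 | i_gt0] := posnP i.
  have j_lt : (j < @ord_max n.-1)%N.
    rewrite ltn_neqAle leq_ord andbT; apply: contra nP => jmax.
    by rewrite lt_ij /= -!val_eqE /= i0.
  have /addrI := cg _ _ j_lt i ord_max; rewrite eqxx mulr1n => ->.
  by rewrite -val_eqE /= ltn_eqF.
have := cg ord0 i i_gt0 ord0 j; rewrite eqxx mulr1n => /addrI<-.
by rewrite -val_eqE /= gtn_eqF.
Qed.

Lemma row_commg (S T : pred 'I_N) : (forall j k, (j < k)%N -> S j -> T k) ->
  [~: pat (row_pattern S), U] \subset pat (row_pattern T).
Proof.
move=> ST; rewrite /= -pat_full; apply: pat_commg => i j k lt_ij lt_jk //=.
- by move=> /andP[-> Sj] _; rewrite (ST j).
- by move=> _; rewrite (negPf (ord0_lt lt_ij)).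
- by move=> _; rewrite (negPf (ord0_lt lt_ij)).
by rewrite (negPf (ord0_lt lt_ij)).
Qed.

(** On the subgroup of the first row with entry j0 equal to 0, the character is
    supported on its kernel: an element with a nonzero entry i < j0 is conjugate
    to its products with the elements of the root subgroup at (0, j0), which act
    as scalars that are not all 1. *)
Lemma row_fixed (G : {group {'GL_n[F]}}) (t : Iirr G) (j0 : 'I_N) c :
    G \subset U -> (0 < j0)%N ->
    pat (row_pattern predT) \subset G ->
    (forall (i : 'I_N) d, (0 < i)%N -> (i < j0)%N -> transv i j0 d \in G) ->
    pat (row_pattern [pred j : 'I_N | j0 < j]%N) \subset cfker 'chi_t ->
    'chi_t (transv ord0 j0 c) != 'chi_t 1%g ->
  '['Res[pat (row_pattern [pred j | j != j0])] 'chi_t, 1]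
    = #|pat (row_pattern [pred j : 'I_N | j0 < j]%N)|%:R
      / #|pat (row_pattern [pred j | j != j0])|%:R * 'chi_t 1%g.
Proof.
move=> sGU j0_gt0 sVG Gt ker_t nz.
set K := pat _; set L := pat _.
have sKV : K \subset pat (row_pattern predT).
  by apply: pat_sub => i j _ /andP[/= ->].
have Gz : transv ord0 j0 c \in G by apply: (subsetP sVG); apply: mem_transv.
apply: cfdot_Res_vanish => //; first exact: subset_trans sKV sVG.
  by apply: pat_sub => i j _ /andP[/= -> lt_j]; rewrite -val_eqE gtn_eqF.
move=> x Kx nLx; have Vx := subsetP sKV x Kx.
have [i i_gt0 /andP[lt_i nz_i]] : exists2 i : 'I_N,
    (0 < i)%N & (i < j0)%N && (GLval x ord0 i != 0).
  apply/exists_inP; apply: contraR nLx => /exists_inPn no_i.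
  apply/patP => k l nP; apply/eqP; rewrite !mxE subr_eq0.
  have [lt_kl | le_lk] := ltnP k l; last first.
    by rewrite (pat_entry Kx) // ltnNge le_lk.
  rewrite lt_kl /= in nP; have [k0 | k0] := eqVneq k ord0; last first.
    by rewrite (pat_entry Kx) //= (negPf k0) andbF.
  rewrite k0 eqxx /= -leqNgt leq_eqVlt in nP.
  rewrite k0 in lt_kl *.
  case/orP: nP => [/eqP l_j0 | lt_l].
    by rewrite (pat_entry Kx) //= (val_inj l_j0) eqxx !andbF.
  by have := no_i l lt_kl; rewrite lt_l -val_eqE /= (ltn_eqF lt_kl) negbK.
(* This choice adds c to the entry (0, j0) of x. *)
have xyE := row_conj_transv (c / GLval x ord0 i) Vx i_gt0 lt_i.
rewrite divfK // in xyE.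
apply: cfcenter_vanish xyE nz; first last.
- by rewrite Gt.
- exact: subsetP sVG x Vx.
apply: mem_cfcenter => // y Gy; apply: (subsetP ker_t).
have /row_commg/subsetP : forall j k : 'I_N, (j < k)%N -> pred1 j0 j -> (j0 < k)%N.
  by move=> j k lt_jk /eqP<-.
by apply; rewrite mem_commg ?(subsetP sGU) ?mem_transv //=.
Qed.

End Bound.

(** * Characters of the Heisenberg group and degenerate characters *)
Section HookCharacters.
Variables (F : finFieldType) (n : nat).
Local Notation N := n.-1.+1.
Local Notation U := (unitri_group F n).
Local Notation pat := (pat F).
Local Notation X := (pat_group F (corner n)).
Local Notation V := (pat_group F (@row_pattern n predT)).
Local Notation K := (pat_group F (@row_pattern n [pred j | j != ord_max])).
Local Notation R := (pat_group F (hook n)).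
Implicit Types (i j : 'I_N) (P Q : pattern n).

Lemma row_sdprod : K ><| X = V.
Proof.
apply: pat_sdprod => [i j _ | i j _ /andP[/= ->] // | i j k lt_ij _ _ | i j k lt_ij _ _] /=.
- by rewrite andbT; case: (i == ord0) => //=; case: (j == ord_max).
- by rewrite (negPf (ord0_lt lt_ij)).
by rewrite (negPf (ord0_lt lt_ij)).
Qed.

Lemma corner_lin (k : Iirr X) : 'chi_k \is a linear_char.
Proof.
apply/char_abelianP: k; apply: abelianS (corner_sub_center F n) _.
exact: center_abelian.
Qed.

Lemma card_row_lt_max : #|K| = (#|F| ^ (n - 2))%N.
Proof.
rewrite card_row -card_inner; congr (_ ^ _)%N; apply: eq_card => j.
by rewrite !inE /= -val_eqE /= (ltn_neqAle j) leq_ord andbT.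
Qed.

Lemma corner_nontriv (G : {group {'GL_n[F]}}) (t : Iirr G) (k : Iirr X) :
    X \subset G -> 'Res[X] 'chi_t = 'chi_t 1%g *: 'chi_k -> k != 0 ->
  exists c, 'chi_t (transv ord0 ord_max c) != 'chi_t 1%g.
Proof.
move=> sXG tX nz_k; apply/existsP; apply: contraR nz_k => /existsPn triv_t.
have kerX : X \subset cfker 'chi_t.
  apply: pat_subP => i j c lt_ij /andP[/eqP i0 /eqP jm].
  rewrite /= cfkerEirr inE i0 jm.
  exact: negbNE (triv_t c).
have := cfRes_sub_ker kerX; rewrite tX => /(scalerI (irr1_neq0 t)) e.
by rewrite -irr_eq1 e.
Qed.

(** The Stone-von Neumann theorem for the Heisenberg group R.  The number of
    fixed vectors of K is the degree divided by |K| = q^(n-2), so the degree is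
    at least |K|, which is also the index in R of the abelian group V. *)
Lemma hook_irr (t : Iirr R) (k : Iirr X) : (1 < n)%N ->
    'Res[X] 'chi_t = 'chi_t 1%g *: 'chi_k -> k != 0 ->
  'chi_t = 'Ind[R] (cfSdprod row_sdprod 'chi_k).
Proof.
move=> n_gt1 tX nz_k.
have sVR : V \subset R by apply: pat_sub => i j _ /andP[/= ->].
have sXV : X \subset V by apply: pat_sub => i j _ /andP[/= ->].
have sKV : K \subset V by apply: pat_sub => i j _ /andP[/= ->].
have max_gt0 : (0 < @ord_max n.-1)%N by rewrite /= -subn1 subn_gt0.
have [c ntriv_t] := corner_nontriv (subset_trans sXV sVR) tX nz_k.
have L1 : pat (@row_pattern n [pred j : 'I_N | @ord_max n.-1 < j]%N) = 1%g.
  apply/trivgP; apply: pat_subP => i j d _ /andP[_ /= lt_j].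
  by have := leq_trans lt_j (leq_ord j); rewrite ltnn.
have fixK : '['Res[K] 'chi_t, 1] = (#|F| ^ (n - 2))%N%:R^-1 * 'chi_t 1%g.
  rewrite -card_row_lt_max (row_fixed _ max_gt0 sVR _ _ ntriv_t) //.
  - by rewrite L1 cards1 mul1r.
  - exact: pat_sub_unitri.
  - by move=> i d _ lt_i; rewrite mem_transv //= ?eqxx ?orbT.
  by rewrite L1 sub1G.
have q_gt0 : (0 < (#|F| ^ (n - 2))%N%:R :> algC).
  by rewrite ltr0n expn_gt0; apply/orP; left; apply/card_gt0P; exists 0.
have nz_fixK : '['Res[K] 'chi_t, 1] != 0.
  by rewrite fixK mulf_neq0 ?irr1_neq0 ?invr_eq0 // gt_eqF.
have deg_t : (#|F| ^ (n - 2))%N%:R <= 'chi_t 1%g.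
  have /natrP[m Dm] : '['Res[K] 'chi_t, 1] \in Num.nat.
    by rewrite Cnat_cfdot_char ?cfRes_char ?irr_char ?cfun1_char.
  rewrite Dm pnatr_eq0 -lt0n in nz_fixK; rewrite -[leLHS]mulr1.
  by rewrite -ler_pdivlMl // -fixK Dm ler1n.
have sV'K : [~: V, V] \subset K.
  by apply: pat_commg => i j k1 lt_ij lt_jk /=; rewrite ?(negPf (ord0_lt lt_ij)).
have [j [lin_j kerK t_j]] := lin_constt_fixed sKV sVR sV'K nz_fixK.
have jX : 'Res[X] 'chi_j = 'chi_k.
  have -> : 'chi_k = 'chi_j 1%g *: 'chi_k by rewrite lin_char1 ?scale1r.
  apply: (@isotypic_constt _ V X ('Res[V] 'chi_t)) => //; last by rewrite -constt_Ind_Res.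
  - by rewrite cfRes_char ?irr_char.
  - exact: corner_lin.
  by rewrite cfResRes // cfRes1.
rewrite -jX cfRes_sdprodK //; apply/esym/constt_eq_deg => //.
  by rewrite cfInd_char ?irr_char.
by rewrite cfInd1 // lin_char1 // mulr1 /= indexg_hook_row.
Qed.

(** Let j0 be the last column such that the character is not trivial on the entry
    (0, j0); as it is trivial on the corner, j0 < n-1.  If there is none, the
    whole first row is in the kernel and any column will do. *)
Lemma degenerate_irr1_le (t : Iirr U) : (2 < n)%N -> X \subset cfker 'chi_t ->
  'chi_t 1%g * #|F|%:R <= (#|F| ^ mu n)%N%:R.
Proof.
move=> n_gt2 kerX.
have sVU : V \subset U by apply: pat_sub_unitri.
have n1_gt1 : (1 < n.-1)%N by rewrite -ltnS prednK // (ltn_trans _ n_gt2).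
have [j0 [j0_gt0 j0_lt nz]] : exists j0 : 'I_N, [/\ (0 < j0)%N, (j0 < n.-1)%N
    & '['Res[pat_group F (row_pattern [pred j | j != j0])] 'chi_t, 1] != 0].
  pose B := [pred j : 'I_N | (0 < j)%N
               && [exists c, transv ord0 j c \notin cfker 'chi_t]].
  have kerB (S : pred 'I_N) : (forall j, S j -> ~~ B j) ->
      pat (row_pattern S) \subset cfker 'chi_t.
    move=> SB; apply: pat_subP => i j c lt_ij /andP[/eqP i0 /SB].
    rewrite i0 in lt_ij *; rewrite /= lt_ij negb_exists => /forallP/(_ c).
    by rewrite negbK.
  have [j1 Bj1 | no_B] := pickP B; last first.
    have lt1 : (1 < N)%N by rewrite ltnS ltnW.
    exists (Ordinal lt1); split=> //.
    have sKker : pat (row_pattern [pred j | j != Ordinal lt1]) \subset cfker 'chi_t.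
      by apply: kerB => j _; rewrite no_B.
    by rewrite cfRes_sub_ker // cfdotZl cfnorm1 mulr1 irr1_neq0.
  have [j /andP[j_gt0 /existsP[c ker'_c]] max_j] := arg_maxnP (@nat_of_ord N) Bj1.
  have Uc : transv ord0 j c \in U by rewrite (subsetP sVU) ?mem_transv.
  exists j; split=> //.
    rewrite ltn_neqAle leq_ord andbT; apply: contra ker'_c => /eqP jm.
    by apply: (subsetP kerX); rewrite mem_transv //= -val_eqE /= jm.
  rewrite (row_fixed (c := c)) //.
  - by rewrite mulf_neq0 ?irr1_neq0 // mulf_neq0 ?invr_eq0 ?neq0CG.
  - by move=> i d _ lt_i; rewrite /= -pat_full mem_transv.
  - apply: kerB => l /= lt_jl; apply: contraL lt_jl => /max_j.
    by rewrite -leqNgt.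
  by move: ker'_c; rewrite cfkerEirr inE.
pose M := pat_group F (block (n - 2)./2 j0_gt0 j0_lt).
have sMU : M \subset U by apply: pat_sub_unitri.
have := lin_constt_fixed _ sMU _ nz; case.
- by apply: pat_sub => i j _ /andP[/= /eqP-> _]; rewrite /block_rel eqxx.
- apply: pat_commg; try exact: block_comp.
    by move=> i j k lt_ij _ _ /=; rewrite (negPf (ord0_lt lt_ij)).
  by move=> i j k lt_ij _ _ /=; rewrite (negPf (ord0_lt lt_ij)).
move=> j [lin_j _ t_j].
have := char1_ge_constt _ t_j; rewrite cfInd_char ?irr_char // => /(_ isT).
rewrite cfInd1 // (lin_char1 lin_j) mulr1 => le_t.
apply: le_trans (_ : #|U : M|%:R * #|F|%:R <= _).
  by rewrite ler_wpM2r ?ler0n.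
by rewrite -natrM ler_nat indexg_block_le.
Qed.

End HookCharacters.

(** * Elementary characters and the factorization *)
Section Elementary.
Variables (F : finFieldType) (n : nat).
Hypothesis n_gt1 : (1 < n)%N.
Local Notation N := n.-1.+1.
Local Notation U := (unitri_group F n).
Local Notation pat := (pat F).
Local Notation X := (pat_group F (corner n)).
Local Notation R := (pat_group F (hook n)).
Local Notation A := (arm_compl_group F n (1%N, n.-1)).
Local Notation H := (interval_group F n 2 (n - 2)).
Implicit Types (i j : 'I_N) (P Q : pattern n).

Lemma arm_compl_groupE : A :=: pat (arm_compl_pattern n).
Proof.
apply: gen_root_union => i j lt_ij; rewrite !inE /= eqSS negb_and.
rewrite (leq_trans _ lt_ij) // -leqNgt leq_eqVlt ltnNge leq_ord orbF.
by rewrite -!val_eqE /= (eq_sym n.-1).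
Qed.

Lemma interval_groupE : H :=: pat (middle n).
Proof.
apply: gen_root_union => i j lt_ij; rewrite /= ltnS lt0n -!val_eqE /=; congr (_ && _).
by rewrite neq_ltn [in RHS]leqNgt -ltnS; have := ltn_ord j; lia.
Qed.

(** The hook is generated by root subgroups that do not lie in the
    middle block, hence it is contained in the radical; both are complements of
    the middle block, so that they have the same order. *)
Lemma interval_radicalE : interval_radical F n 2 (n - 2) :=: pat (hook n).
Proof.
have sdU : R ><| pat_group F (middle n) = U.
  rewrite /= -pat_full; apply: pat_sdprod => // [i j _|i j k lt_ij _|i j k _ lt_jk] /=.
  - by case: (i == ord0); case: (j == ord_max).
  - by rewrite (negPf (ord0_lt lt_ij)) /= => _ ->; rewrite orbT.
  by rewrite (negPf (ord_max_lt lt_jk)) orbF => ->.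
apply/esym/eqP; rewrite eqEcard; apply/andP; split.
  pose S := [pred s | ~~ (root_subgroup F n s \subset H)].
  apply: (@subset_trans _ _ <<root_union F n S>>); last first.
    by apply: genS; apply: sub_class_support.
  apply: sub_gen_root_union.
  move=> i j lt_ij hook_ij /=; apply: contraL hook_ij => /subsetP/(_ _ (transv_root 1 lt_ij)).
  by rewrite interval_groupE mem_transv_pat // oner_eq0 /= negb_or.
rewrite -(leq_pmul2r (cardG_gt0 H)) (sdprod_card (interval_sdprod _ _ _ _)).
by rewrite interval_groupE (sdprod_card sdU).
Qed.

Lemma arm_compl_sdprod : pat (below n) ><| pat (corner n) = A.
Proof.
rewrite arm_compl_groupE; apply: pat_sdprod => [i j _|i j _|i j k _ lt_jk|i j k _ _] //=.
- by case: (i == ord0); case: (j == ord_max).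
- by move=> ->.
by rewrite (negPf (ord_max_lt lt_jk)) andbF.
Qed.

(** The linear character of V_alpha, for alpha the highest root, that is trivial
    on the other root subgroups and equals 'chi_k on the corner. *)
Definition elem_lin (k : Iirr X) : 'CF(A) := cfSdprod arm_compl_sdprod 'chi_k.

Definition elem (k : Iirr X) : 'CF(U) := 'Ind[U] (elem_lin k).

Lemma elem_lin_lin k : elem_lin k \is a linear_char.
Proof. by rewrite cfSdprod_lin_char corner_lin. Qed.

Lemma elem_char k : elem k \is a character.
Proof. by rewrite cfInd_char ?lin_charW ?elem_lin_lin. Qed.

Lemma elem1 k : elem k 1%g = (#|F| ^ (n - 2))%N%:R.
Proof.
rewrite cfInd1 ?arm_compl_groupE ?pat_sub_unitri //.
by rewrite lin_char1 ?elem_lin_lin // mulr1 arm_compl_groupE indexg_arm_compl.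
Qed.

Lemma elem_corner k : 'Res[X] (elem k) = elem k 1%g *: 'chi_k.
Proof.
have sAU : A \subset U by rewrite arm_compl_groupE pat_sub_unitri.
apply/cfun_inP=> x Xx.
have Ux := subsetP (pat_sub_unitri F _) x Xx.
rewrite cfResE ?pat_sub_unitri // cfunE cfInd_center //; last first.
  exact: subsetP (corner_sub_center F n) x Xx.
by rewrite cfInd1 // (lin_char1 (elem_lin_lin k)) mulr1 cfSdprodEr.
Qed.

(** The degree of the elementary character is that of any irreducible character
    of R over 'chi_k. *)
Lemma elem_Res_hook k : k != 0 -> 'Res[R] (elem k) \in irr R.
Proof.
move=> nz_k; have sRU : R \subset U by apply: pat_sub_unitri.
have sXR : X \subset R by apply: pat_sub => i j _ /andP[/= ->].
have NE : 'Res[R] (elem k) \is a character by rewrite cfRes_char ?elem_char.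
have q_gt0 : (0 < #|F|)%N by apply/card_gt0P; exists 0.
have nzE : 'Res[R] (elem k) != 0.
  by rewrite -char1_eq0 // cfRes1 elem1 pnatr_eq0 -lt0n expn_gt0 q_gt0.
have [t Et] := neq0_has_constt nzE.
have tX : 'Res[X] 'chi_t = 'chi_t 1%g *: 'chi_k.
  by apply: isotypic_constt Et => //; rewrite ?corner_lin // cfResRes ?cfRes1 ?elem_corner.
have deg_t : 'chi_t 1%g = (#|F| ^ (n - 2))%N%:R.
  rewrite (hook_irr n_gt1 tX nz_k) cfInd1.
    by rewrite cfSdprod1 (lin_char1 (corner_lin k)) mulr1 /= indexg_hook_row.
  by apply: pat_sub => i j _ /andP[/= ->].
by rewrite (constt_eq_deg NE Et) ?mem_irr // cfRes1 elem1 deg_t.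
Qed.

(** By the uniqueness of the irreducible character of R over 'chi_k, all the
    irreducible characters of U over 'chi_k lie over the restriction to R of the
    elementary character, and Gallagher's theorem describes them. *)
Lemma elem_factor k : k != 0 ->
  [/\ forall j : Iirr H, elem k * inflate 'chi_j \in irr U,
      {in irr H &, injective (fun theta => elem k * inflate theta)}
    & forall t, 'Res[X] 'chi_t = 'chi_t 1%g *: 'chi_k ->
        exists j : Iirr H, 'chi_t = elem k * inflate 'chi[H]_j].
Proof.
move=> nz_k; have eR : interval_radical F n 2 (n - 2) = R.
  exact/group_inj/interval_radicalE.
have sXR : X \subset R by apply: pat_sub => i j _ /andP[/= ->].
have sRU : R \subset U by apply: pat_sub_unitri.
have irrE : 'Res[interval_radical F n 2 (n - 2)] (elem k)
              \in irr (interval_radical F n 2 (n - 2)).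
  by rewrite eR elem_Res_hook.
have irr_e : elem k \in irr U by apply: cfRes_irr_irr irrE; apply: elem_char.
have [irrM injM allM] := gallagher_sdprod (interval_sdprod F n 2 (n - 2)) irr_e irrE.
split=> // t tX; apply: allM; rewrite eR.
have uniq_k s (psi : 'CF(R)) : psi \is a character -> s \in irr_constt psi ->
    'Res[X] psi = psi 1%g *: 'chi_k ->
    'chi_s = 'Ind[R] (cfSdprod (row_sdprod F n) 'chi_k).
  move=> Npsi psi_s psiX; apply: (hook_irr n_gt1) => //.
  exact: isotypic_constt Npsi (corner_lin k) psiX psi_s.
have NR (psi : 'CF(U)) : psi \is a character -> 'Res[R] psi \is a character.
  exact: cfRes_char.
have [s t_s] := constt_cfRes_irr R t.
have /irrP[e De] := elem_Res_hook nz_k.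
have -> : 'Res[R] (elem k) = 'chi_s.
  rewrite De (uniq_k e 'chi_e) ?irr_char ?irr_consttE ?cfnorm_irr ?oner_eq0 //.
    by rewrite (uniq_k s _ _ t_s) ?NR ?irr_char // cfResRes ?cfRes1.
  by rewrite -De cfResRes ?cfRes1 ?elem_corner.
by rewrite -irr_consttE.
Qed.

Lemma mul_inflate_corner k (theta : 'CF(H)) (chi := elem k * inflate theta) :
  'Res[X] chi = chi 1%g *: 'chi_k.
Proof.
have sXU : X \subset U by apply: pat_sub_unitri.
have sXR : X \subset R by apply: pat_sub => i j _ /andP[/= ->].
apply/cfun_inP=> x Xx; rewrite cfResE // !cfunE.
have -> : elem k x = elem k 1%g * 'chi_k x.
  by rewrite -(cfResE (elem k) sXU Xx) elem_corner cfunE.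
rewrite mulrAC; congr (_ * _ * _); apply: cfker1.
by rewrite (subsetP (cfker_sdprod _ _)) // interval_radicalE (subsetP sXR).
Qed.

Lemma mul_inflate1 k (theta : 'CF(H)) :
  (elem k * inflate theta) 1%g = (#|F| ^ (n - 2))%N%:R * theta 1%g.
Proof. by rewrite cfunE elem1 /inflate cfSdprod1. Qed.

End Elementary.

(** * The almost faithful elementary characters *)
Section ElementaryClassification.
Variables (F : finFieldType) (n : nat).
Hypothesis n_gt1 : (1 < n)%N.
Local Notation N := n.-1.+1.
Local Notation U := (unitri_group F n).
Local Notation pat := (pat F).
Local Notation X := (pat_group F (corner n)).
Local Notation A := (arm_compl_group F n (1%N, n.-1)).
Implicit Types (i j : 'I_N) (P Q : pattern n).

Lemma posroot_top : posroot n (1%N, n.-1).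
Proof. by rewrite /posroot /=; lia. Qed.

Lemma posroot_ordP s : posroot n s ->
  exists i j, (i < j)%N /\ s = (i.+1, nat_of_ord j).
Proof.
case: s => a b /andP[/andP[/= a_gt0 le_ab] lt_bn].
have lt_b : (b < N)%N by lia.
have lt_a : (a.-1 < N)%N by lia.
by exists (Ordinal lt_a), (Ordinal lt_b); rewrite /= prednK.
Qed.

Lemma ord_max_gt0 : (@ord0 n.-1 < @ord_max n.-1)%N.
Proof. by rewrite /=; lia. Qed.

Lemma elem_lin_elementary (k : Iirr X) : k != 0 -> elementary_linear (elem_lin k).
Proof.
move=> nz_k; split=> [||b pb sbA ne_b x Xx]; first exact: elem_lin_lin.
  have kX : 'Res[X] 'chi_k = 'chi_k 1%g *: 'chi_k.
    by rewrite cfRes_id (lin_char1 (corner_lin k)) scale1r.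
  have [c] := corner_nontriv (subxx X) kX nz_k.
  rewrite (lin_char1 (corner_lin k)) => nz.
  exists (transv ord0 ord_max c); first by apply: transv_root ord_max_gt0.
  by rewrite cfSdprodEr ?mem_transv ?ord_max_gt0 //= !eqxx.
have [i [j [lt_ij def_b]]] := posroot_ordP pb; rewrite {b}def_b in pb sbA ne_b Xx.
have nz_i : i != ord0.
  apply: contraNneq ne_b => i0.
  have := subsetP sbA _ (transv_root 1 lt_ij).
  by rewrite arm_compl_groupE mem_transv_pat // oner_eq0 i0 /= => /eqP->.
have Bx : x \in pat (below n).
  by have [c ->] := root_subgroup_transv lt_ij Xx; rewrite mem_transv.
rewrite -(lin_char1 (elem_lin_lin k)); apply: cfker1.
by rewrite (subsetP (cfker_sdprod _ _)).
Qed.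

Lemma elem_elementary (k : Iirr X) : k != 0 -> elementary (elem k).
Proof.
move=> nz_k; exists (1%N, n.-1); split; first exact: posroot_top.
by exists (elem_lin k) => //; apply: elem_lin_elementary.
Qed.

Lemma elem_almost_faithful (k : Iirr X) : k != 0 -> almost_faithful (elem k).
Proof.
move=> nz_k trivE; case/negP: nz_k; rewrite -irr_eq1; apply/eqP/cfun_inP=> x Xx.
have Zx : x \in 'Z(U) by rewrite center_unitri.
have := congr1 (fun f : 'CF('Z(U)) => f x) trivE.
rewrite /= cfResE ?center_sub // cfunE !cfun1E Zx Xx mulr1 => Ex.
have : 'Res[X] (elem k) x = elem k 1%g * 'chi_k x by rewrite elem_corner // cfunE.
rewrite cfResE ?pat_sub_unitri // Ex elem1 // => /esym e.
apply: (mulfI _ (etrans e (esym (mulr1 _)))).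
rewrite pnatr_eq0 -lt0n expn_gt0; apply/orP; left; apply/card_gt0P; by exists 0.
Qed.

(** For any root a other than the highest one, the corner is contained in V_a and
    in the kernel of the linear character; being central, it is then in the
    kernel of the induced character. *)
Lemma elementary_elem (chi : 'CF(U)) : elementary chi -> almost_faithful chi ->
  exists2 k, k != 0 & chi = elem k.
Proof.
case=> a [pa [lam [lin_lam nontriv triv] ->]] af.
have lamK (P : pattern n) : (forall i j, (i < j)%N -> P i j ->
      root_subgroup F n (i.+1, nat_of_ord j) \subset arm_compl_group F n a
      /\ (i.+1, nat_of_ord j) != a) -> pat P \subset cfker lam.
  move=> sP; apply: pat_subP => i j c lt_ij /(sP _ _ lt_ij)[sA ne_a].
  rewrite /= cfkerEchar ?lin_charW // inE (subsetP sA) ?transv_root //=.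
  by rewrite (lin_char1 lin_lam) (triv _ (posroot_of_ord lt_ij)) ?transv_root.
have [def_a | ne_a] := eqVneq a (1%N, n.-1).
  subst a; have /irrP[k Dk] : 'Res[X] lam \in irr X.
    exact/lin_char_irr/cfRes_lin_char.
  have Elam : lam = elem_lin k.
    rewrite /elem_lin -Dk cfRes_sdprodK //; apply: lamK => i j lt_ij /= nz_i; split.
      rewrite arm_compl_groupE; apply/subsetP=> x /(root_subgroup_transv lt_ij)[c ->].
      by rewrite mem_transv //= nz_i.
    by rewrite xpair_eqE eqSS negb_and; move: nz_i; rewrite -val_eqE /= => ->.
  exists k; last by rewrite /elem -Elam.
  apply: contraTneq isT => k0; case: nontriv => x Xx.
  have [c def_x] := root_subgroup_transv ord_max_gt0 Xx.
  rewrite Elam k0 cfSdprodEr ?irr0 ?cfun1E def_x mem_transv ?ord_max_gt0 //= ?eqxx //.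
case: af; have sAU : arm_compl_group F n a \subset U.
  by rewrite gen_subG root_union_sub_unitri.
have kerX : X \subset cfker lam.
  apply: lamK => i j lt_ij /andP[/eqP-> /eqP->]; split; last by rewrite eq_sym.
  apply/subsetP=> x Xx; apply/mem_gen/root_unionP; exists (1%N, n.-1) => //.
  rewrite posroot_top /= negb_and; apply/orP; right; apply/nandP; right.
  have /andP[_ lt_a] := pa; rewrite -leqNgt -ltnS prednK //; exact: ltn_trans n_gt1.
apply/cfun_inP=> z Zz; have Xz : z \in X by rewrite /= -center_unitri.
rewrite cfResE ?center_sub // cfunE cfun1E Zz mulr1 cfInd_center // cfInd1 //.
by rewrite (cfker1 (subsetP kerX z Xz)).
Qed.

End ElementaryClassification.

(** * The middle block as a smaller unitriangular group *)
Section MiddleBlock.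
Variables (F : finFieldType) (p : nat).
Local Notation M := (pat_group F (middle p.+3)).
Implicit Types (g h : {'GL_p.+3[F]}).

Definition mid_ord (k : 'I_p.+1) : 'I_p.+3 := lift ord0 (widen_ord (leqnSn _) k).

Lemma mid_ord_inj : injective mid_ord.
Proof. by move=> i j /lift_inj/(congr1 val)/= /val_inj. Qed.

Lemma mid_ordP (k : 'I_p.+3) : k != ord0 -> k != ord_max -> exists k', k = mid_ord k'.
Proof.
rewrite -!val_eqE /= => k0 k_max; have lt_k : (k.-1 < p.+1)%N.
  by have := ltn_ord k; lia.
by exists (Ordinal lt_k); apply: val_inj; rewrite /= /bump /=; lia.
Qed.

Lemma mid_ord_middle (i j : 'I_p.+1) : middle p.+3 (mid_ord i) (mid_ord j).
Proof. by rewrite /= -!val_eqE /= /bump /=; have := ltn_ord j; lia. Qed.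

Definition mid_submx g : {'GL_p.+1[F]} :=
  gl (n := p.+1) (mxsub mid_ord mid_ord (GLval g)).

Lemma mid_submxE g : g \in M -> GLval (mid_submx g) = mxsub mid_ord mid_ord (GLval g).
Proof.
move=> Mg; apply: glK => i j; rewrite andbT -leqNgt => le_ji.
rewrite !mxE (pat_entry Mg) /= ?(inj_eq mid_ord_inj) ?subrr //.
by rewrite /bump /= !add1n ltnS ltnNge le_ji.
Qed.

(** Deleting the first and last rows and columns is multiplicative on matrices
    that agree with 1 there. *)
Lemma mid_submxM : {in M &, {morph mid_submx : g h / (g * h)%g}}.
Proof.
move=> g h Mg Mh.
suffices: GLval (mid_submx (g * h)) = GLval (mid_submx g * mid_submx h) by apply: val_inj.
rewrite GL_MxE !mid_submxE ?groupM //; apply/matrixP => i j.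
rewrite GL_MxE !mxE big_ord_recl big_ord_recr /=.
rewrite (pat_entry Mg) ?andbF // mul0r add0r.
rewrite [X in _ + _ * X](pat_entry Mh) ?andbF //; last first.
  rewrite negb_and -leqNgt; apply/orP; left.
  by rewrite /= /bump /= !add1n ltnS ltnW.
rewrite -val_eqE /= /bump /= gtn_eqF; last by rewrite !add1n ltnS ltn_ord.
by rewrite mulr0 addr0; apply: eq_bigr => k _; rewrite !mxE.
Qed.
Canonical mid_submx_morphism := Morphism mid_submxM.

Lemma mid_submx_isom : isom M (unitri_group F p.+1) mid_submx.
Proof.
have injS : 'injm mid_submx_morphism.
  apply/subsetP=> g /setIP[Mg]; rewrite !inE => /eqP g1; apply/eqP/GL_eq1 => i j.
  case: (boolP ((i < j)%N && middle p.+3 i j)); last exact: pat_entry Mg.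
  case/and3P=> lt_ij i0 jm.
  have [i' def_i] := mid_ordP i0 (ord_max_lt lt_ij).
  have [j' def_j] := mid_ordP (ord0_lt lt_ij) jm.
  have : GLval (mid_submx g) i' j' = (i' == j')%:R by rewrite [mid_submx g]g1 GL_1E mxE.
  by rewrite mid_submxE // mxE -def_i -def_j => ->; rewrite def_i def_j (inj_eq mid_ord_inj).
apply/isomP; split=> //; apply/setP=> h; rewrite /= -pat_full.
apply/morphimP/idP => [[g _ Mg ->] | Uh].
  apply: gl_pat => i j; rewrite andbT -leqNgt => le_ji.
  rewrite !mxE (pat_entry Mg) /= ?(inj_eq mid_ord_inj) ?subrr //.
  by rewrite /bump /= !add1n ltnS ltnNge le_ji.
pose B : 'M[F]_p.+3 := \matrix_(i, j) if middle p.+3 i j && (i < j)%N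
  then GLval h (inord i.-1) (inord j.-1) else (i == j)%:R.
have sB : supported (middle p.+3) (B - 1).
  by move=> i j nP; rewrite !mxE andbC (negPf nP) subrr.
exists (gl (n := p.+3) B); rewrite ?gl_pat //.
suffices: GLval h = GLval (mid_submx (gl (n := p.+3) B)) by apply: val_inj.
rewrite mid_submxE ?gl_pat // glK; last exact: supported_full sB.
apply/matrixP=> i j; rewrite !mxE mid_ord_middle /= /bump /= !add1n ltnS /= !inord_val.
case: ltnP => // le_ji; rewrite (pat_entry Uh) ?(inj_eq mid_ord_inj) //.
by rewrite ltnNge le_ji.
Qed.

End MiddleBlock.

(** * Largest degrees *)
Section Counting.
Variable F : finFieldType.

Lemma card_field_gt1 : (1 < #|F|)%N.
Proof. exact: finNzRing_gt1. Qed.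

Lemma interval_Iirr_bij n : (2 < n)%N ->
  exists2 f : Iirr (interval_group F n 2 (n - 2)) -> Iirr (unitri_group F (n - 2)),
    bijective f & forall j, 'chi_(f j) 1%g = 'chi_j 1%g.
Proof.
case: n => // -[] // -[] // p _.
have -> : interval_group F p.+3 2 (p.+3 - 2) = pat_group F (middle p.+3).
  by apply: group_inj; apply: interval_groupE.
rewrite -[(p.+3 - 2)%N]/p.+1.
have isoM := mid_submx_isom F p; exists (isom_Iirr isoM).
  by exists (isom_Iirr (isom_sym isoM)) => i; rewrite ?isom_IirrK ?isom_IirrKV.
by move=> j; rewrite isom_IirrE cfIsom1.
Qed.

Section Corner.
Variable n : nat.
Hypothesis n_gt2 : (2 < n)%N.
Local Notation U := (unitri_group F n).
Local Notation X := (pat_group F (corner n)).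
Local Notation H := (interval_group F n 2 (n - 2)).

Lemma corner_isotypic (t : Iirr U) :
  exists k, 'Res[X] 'chi_t = 'chi_t 1%g *: 'chi_k.
Proof. by apply: isotypic_center; apply: corner_sub_center. Qed.

Lemma card_corner : #|Iirr X| = #|F|.
Proof.
rewrite card_Iirr_abelian; last first.
  by apply: abelianS (corner_sub_center F n) _; apply: center_abelian.
rewrite card_row (_ : [set j | _] = [set ord_max]) ?cards1 ?expn1 //.
apply/setP=> j; rewrite !inE /=; case: eqP => [-> | _]; rewrite ?andbF //.
by rewrite /=; lia.
Qed.

Lemma degenerate_isotypic t : 'Res[X] 'chi[U]_t = 'chi_t 1%g *: 'chi_0 ->
  'chi_t 1%g * #|F|%:R <= (#|F| ^ mu n)%N%:R.
Proof.
move=> tX; apply: degenerate_irr1_le => //; apply/subsetP=> x Xx.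
rewrite cfkerEirr inE -(cfResE _ (pat_sub_unitri F (corner n)) Xx) tX cfunE.
by rewrite irr0 cfun1E Xx mulr1.
Qed.

End Corner.

Lemma unitri_irr1_le n (t : Iirr (unitri_group F n)) :
  'chi_t 1%g <= (#|F| ^ mu n)%N%:R.
Proof.
have [m] := ubnP n; elim: m n t => // m IHm n t; rewrite ltnS => le_nm.
have [le_n2 | n_gt2] := leqP n 2.
  have cUU : abelian (unitri_group F n).
    apply: abelianS (_ : _ \subset 'Z(unitri_group F n)) (center_abelian _).
    rewrite center_unitri /= -pat_full; apply: pat_sub => i j lt_ij _ /=.
    rewrite -!val_eqE /=; have := ltn_ord j; lia.
  rewrite lin_char1; last by have /char_abelianP := cUU.
  by rewrite ler1n expn_gt0 (ltnW card_field_gt1).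
have [k tX] := corner_isotypic t.
have [k0 | nz_k] := eqVneq k 0.
  rewrite k0 in tX; apply: le_trans (degenerate_isotypic n_gt2 tX).
  by rewrite ler_peMr ?ler1n ?(ltnW card_field_gt1) // char1_ge0 ?irr_char.
have [_ _ /(_ t tX)[j ->]] := elem_factor (ltnW n_gt2) nz_k.
have [f _ degf] := interval_Iirr_bij n_gt2.
rewrite mul_inflate1 mu_rec ?(ltnW n_gt2) // addnC expnD natrM -degf.
by rewrite ler_wpM2l ?ler0n // IHm //; lia.
Qed.

Lemma elem_mul_deg n (k : Iirr (pat_group F (corner n))) :
  (2 < n)%N -> forall j : Iirr (interval_group F n 2 (n - 2)),
  ((elem k * inflate 'chi_j) 1%g == (#|F| ^ mu n)%N%:R)
    = ('chi_j 1%g == (#|F| ^ mu (n - 2))%N%:R).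
Proof.
move=> n_gt2 j; rewrite mul_inflate1 mu_rec ?(ltnW n_gt2) // addnC expnD natrM.
rewrite (inj_eq (mulfI _)) // pnatr_eq0 -lt0n expn_gt0.
by rewrite (ltnW card_field_gt1).
Qed.

Lemma exists_irr_mu n : exists t : Iirr (unitri_group F n),
  'chi_t 1%g = (#|F| ^ mu n)%N%:R.
Proof.
have [m] := ubnP n; elim: m n => // m IHm n; rewrite ltnS => le_nm.
have [le_n2 | n_gt2] := leqP n 2.
  exists 0; rewrite irr0 cfun11 [mu n](_ : _ = 0%N) //.
  by case: n le_n2 {le_nm} => [|[|[|]]].
have [|t deg_t] := IHm (n - 2)%N; first lia.
have [f [g _ gK] degf] := interval_Iirr_bij n_gt2.
have [k nz_k] : exists k : Iirr (pat_group F (corner n)), k != 0.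
  apply/existsP; rewrite -negb_forall; apply/negP => /forallP all0.
  have := card_field_gt1; rewrite -(card_corner n_gt2) (eq_card (B := pred1 0)).
    by rewrite card1.
  by move=> k; rewrite !inE (eqP (all0 k)) eqxx.
have [/(_ (g t))/irrP[s Ds] _ _] := elem_factor (ltnW n_gt2) nz_k.
by exists s; rewrite -Ds; apply/eqP; rewrite elem_mul_deg // -degf gK deg_t.
Qed.

Lemma largest_degreeE n (chi : 'CF(unitri_group F n)) :
  largest_degree_irr chi <-> chi \in irr (unitri_group F n)
    /\ chi 1%g = (#|F| ^ mu n)%N%:R.
Proof.
split=> -[irr_chi]; last by move=> deg; split=> // t; rewrite deg unitri_irr1_le.
have [s deg_s] := exists_irr_mu n; move/(_ s); rewrite deg_s => ge_chi.
split=> //; apply/eqP; rewrite eq_le ge_chi andbT.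
by have /irrP[t ->] := irr_chi; apply: unitri_irr1_le.
Qed.

End Counting.

(** * The largest degree characters *)
Section Factorization.
Variables (F : finFieldType) (n : nat).
Hypothesis n_gt2 : (2 < n)%N.
Local Notation U := (unitri_group F n).
Local Notation X := (pat_group F (corner n)).
Local Notation H := (interval_group F n 2 (n - 2)).
Let n_gt1 : (1 < n)%N := ltnW n_gt2.

Lemma largest_degree_intervalE (theta : 'CF(H)) :
  largest_degree_irr theta <-> theta \in irr H
    /\ theta 1%g = (#|F| ^ mu (n - 2))%N%:R.
Proof.
have [f [g fK gK] degf] := interval_Iirr_bij F n_gt2.
split=> [] [/irrP[j ->]].
  move=> max_j; split; first exact: mem_irr.
  have [s deg_s] := exists_irr_mu F (n - 2); have := max_j (g s).
  rewrite -!degf gK deg_s => ge_j; apply/eqP.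
  by rewrite eq_le ge_j unitri_irr1_le.
by move=> deg_j; split=> [|i]; rewrite ?mem_irr // deg_j -degf; apply: unitri_irr1_le.
Qed.

(** By its degree the character cannot be trivial on the corner, so that
    elem_factor applies. *)
Lemma max_irr_factor (t : Iirr U) : 'chi_t 1%g = (#|F| ^ mu n)%N%:R ->
  exists k j, [/\ k != 0 :> Iirr X, 'chi_t = elem k * inflate 'chi[H]_j
    & 'chi_j 1%g = (#|F| ^ mu (n - 2))%N%:R].
Proof.
move=> deg_t; have [k tX] := corner_isotypic t.
have nz_k : k != 0.
  apply/eqP=> k0; rewrite k0 in tX.
  have := degenerate_isotypic n_gt2 tX; rewrite deg_t -natrM ler_nat.
  rewrite leqNgt ltn_Pmulr ?card_field_gt1 // expn_gt0.
  by rewrite (ltnW (card_field_gt1 F)).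
have [_ _ /(_ t tX)[j tE]] := elem_factor n_gt1 nz_k.
by exists k, j; split=> //; apply/eqP; rewrite -(elem_mul_deg k) // -tE deg_t.
Qed.

(** The restriction to the corner recovers the index of the elementary factor. *)
Lemma elem_mul_inj (k1 k2 : Iirr X) (theta1 theta2 : 'CF(H)) :
    k1 != 0 -> theta1 \in irr H -> theta2 \in irr H ->
  elem k1 * inflate theta1 = elem k2 * inflate theta2 ->
  k1 = k2 /\ theta1 = theta2.
Proof.
move=> nz1 irr1 irr2 e12; have [irrM injM _] := elem_factor n_gt1 nz1.
have k12 : k1 = k2.
  apply: irr_inj; have nz : (elem k1 * inflate theta1) 1%g != 0.
    by have /irrP[j ->] := irr1; have /irrP[s ->] := irrM j; apply: irr1_neq0.
  apply: (scalerI nz); rewrite -mul_inflate_corner // e12.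
  by rewrite mul_inflate_corner.
by split=> //; apply: injM => //; rewrite /= e12 k12.
Qed.

Lemma num_irr_deg_max :
  num_irr_deg F n (mu n)
    = ((#|F| - 1) * num_irr_deg F (n - 2) (mu (n - 2)))%N.
Proof.
have [f f_bij degf] := interval_Iirr_bij F n_gt2.
pose T := [set j : Iirr H | 'chi_j 1%g == (#|F| ^ mu (n - 2))%N%:R].
have cardT : num_irr_deg F (n - 2) (mu (n - 2)) = #|T|.
  rewrite /num_irr_deg -(on_card_preimset (onW_bij _ f_bij)).
  by apply: eq_card => j; rewrite !inE degf.
pose prod (kj : Iirr X * Iirr H) := cfIirr (elem kj.1 * inflate 'chi_kj.2).
pose S := setX [set~ (0 : Iirr X)] T.
have prodE kj : kj \in S -> 'chi_(prod kj) = elem kj.1 * inflate 'chi_kj.2.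
  case: kj => k j /setXP[]; rewrite !inE => nz_k _.
  by rewrite cfIirrE //; have [] := elem_factor n_gt1 nz_k.
rewrite cardT subn1 -{1}(card_corner F n_gt2) -(cardsC1 (0 : Iirr X)) -cardsX.
rewrite -/S -(card_in_imset (f := prod)).
  apply: eq_card => t; rewrite inE; apply/eqP/imsetP => [deg_t | [[k j] Skj ->]].
    have [k [j [nz_k tE deg_j]]] := max_irr_factor deg_t.
    have Skj : (k, j) \in S by rewrite !inE nz_k deg_j eqxx.
    by exists (k, j) => //; apply: irr_inj; rewrite prodE.
  rewrite prodE //; apply/eqP; rewrite elem_mul_deg //.
  by move: Skj; rewrite !inE => /andP[].
move=> [k1 j1] [k2 j2] S1 S2 /(congr1 (fun t => 'chi_t)); rewrite !prodE //=.
move/elem_mul_inj; rewrite !mem_irr => /(_ _ isT isT).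
by case=> [|-> /irr_inj->]; first by move: S1; rewrite !inE => /andP[].
Qed.

End Factorization.

Theorem lemma4p1p1 (F : finFieldType) (n : nat) (hn : (3 <= n)%N) :
  (forall chi : 'CF(unitri F n), largest_degree_irr chi ->
     chi 1%g = (#|F| ^ mu n)%N%:R
     /\ exists! p : 'CF(unitri F n) * 'CF(interval_group F n 2 (n - 2)),
          [/\ elementary p.1, almost_faithful p.1, largest_degree_irr p.2
            & chi = p.1 * inflate p.2])
  /\ num_irr_deg F n (mu n)
     = ((#|F| - 1) * num_irr_deg F (n - 2) (mu (n - 2)))%N.
Proof.
split; last exact: num_irr_deg_max.
move=> chi /largest_degreeE[/irrP[t ->] deg_t]; split=> //.
have n_gt1 : (1 < n)%N := ltnW hn.
have [k [j [nz_k tE deg_j]]] := max_irr_factor hn deg_t.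
exists (elem k, 'chi_j); split=> [|[E theta]] /=.
  split=> //; first exact: elem_elementary.
    exact: elem_almost_faithful.
  by apply/(largest_degree_intervalE hn); rewrite mem_irr.
case=> elE afE /(largest_degree_intervalE hn)[irr_theta _] tE'.
have [k' nz_k' def_E] := elementary_elem n_gt1 elE afE.
have [-> ->] : k = k' /\ 'chi_j = theta.
  by apply: elem_mul_inj; rewrite ?mem_irr // -tE tE' def_E.
by rewrite def_E.
Qed.
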